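(* Let $(\mathscr{C}, S)$ be a suspended additive category, and $\eta \colon 1_{\mathscr{C}} \to S$ a natural transformation with $\eta_{SM} = S\eta_M$ for every object $M$ of $\mathscr{C}$. Let $d \ge 2$ be an even integer, and $(\mathbf{HFact}_d(\mathscr{C},S,\eta),\Sigma,\Delta)$ the triangulated homotopy category of $d$-fold $(\mathscr{C},S)$-factorizations of $\eta$. Fix an object $M \in \mathscr{C}$, and denote the endomorphism ring $\operatorname{Hom}_{\mathscr{C}}(M,M)$ by $\Gamma_M$. (1) The functor $\operatorname{Hom}_{\mathscr{C}}(M,-)$ induces a triangle functor $$(\mathbf{HFact}_d(\mathscr{C},S,\eta),\Sigma,\Delta) \to \mathbf{HSeq}\,\Gamma_M.$$ It maps a $d$-fold factorization $(M_i,f_i)$ to the sequence $$\cdots \xrightarrow{(S^{-1}f_d)_*} \operatorname{Hom}_{\mathscr{C}}(M,M_1) \xrightarrow{(f_1)_*} \cdots \xrightarrow{(f_{d-1})_*} \operatorname{Hom}_{\mathscr{C}}(M,M_d) \xrightarrow{(f_d)_*} \cdots$$ of right $\Gamma_M$-modules, and a homotopy equivalence class of morphisms of $d$-fold factorizations to the corresponding homotopy equivalence class of morphisms of sequences. (2) Suppose that $f$ is a central element of $\Gamma_M$, and that $\eta_M$ factors through $f$. Then the functor $\operatorname{Hom}_{\mathscr{C}}(M,-) \otimes_{\Gamma_M} \Gamma_M/(f)$ induces a triangle functor $$(\mathbf{HFact}_d(\mathscr{C},S,\eta),\Sigma,\Delta) \to \mathbf{K}_d\,\Gamma_M/(f).$$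 It maps a $d$-fold factorization $(M_i,f_i)$ to the $d$-complex $$\cdots \xrightarrow{\overline{(S^{-1}f_d)_*}} \frac{\operatorname{Hom}_{\mathscr{C}}(M,M_1)}{\operatorname{Hom}_{\mathscr{C}}(M,M_1)\cdot f} \xrightarrow{\overline{(f_1)_*}} \cdots \xrightarrow{\overline{(f_{d-1})_*}} \frac{\operatorname{Hom}_{\mathscr{C}}(M,M_d)}{\operatorname{Hom}_{\mathscr{C}}(M,M_d)\cdot f} \xrightarrow{\overline{(f_d)_*}} \cdots$$ of right $\Gamma_M/(f)$-modules, and a homotopy equivalence class of morphisms of $d$-fold factorizations to the corresponding homotopy equivalence class of morphisms of $d$-complexes.
   Context: A suspended additive category $(\mathscr{C},S)$ is an additive category $\mathscr{C}$ together with an additive automorphism $S \colon \mathscr{C} \to \mathscr{C}$. Factorizations. A $d$-fold $(\mathscr{C},S)$-factorization $(M_i,f_i)$ of $\eta$ is a sequence $M_1 \xrightarrow{f_1} M_2 \xrightarrow{f_2} \cdots \xrightarrow{f_{d-1}} M_d \xrightarrow{f_d} SM_1$ of $d$ morphisms in $\mathscr{C}$ in which every $d$-fold composition equals $\eta$: $f_d \circ \cdots \circ f_1 = \eta_{M_1}$, $Sf_1 \circ f_d \circ \cdots \circ f_2 = \eta_{M_2}$, ..., $Sf_{d-1} \circ \cdots \circ Sf_1 \circ f_d = \eta_{M_d}$. A morphism $\varphi \colon (M_i,f_i) \to (N_i,g_i)$ is a sequence $(\varphi_1,\dots,\varphi_d)$ of morphisms $\varphi_i \colon M_i \to N_i$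 in $\mathscr{C}$ with $\varphi_{i+1} \circ f_i = g_i \circ \varphi_i$ for $1 \le i \le d-1$ and $S\varphi_1 \circ f_d = g_d \circ \varphi_d$. This gives an additive category $\mathbf{Fact}_d(\mathscr{C},S,\eta)$. Two morphisms $\varphi,\varphi' \colon (M_i,f_i) \to (N_i,g_i)$ are homotopic if there exist morphisms $s_i \colon M_{i+1} \to N_i$ ($1 \le i \le d-1$) and $s_d \colon SM_1 \to N_d$ in $\mathscr{C}$ such that $\varphi_1 - \varphi_1' = s_1 \circ f_1 + S^{-1}g_d \circ S^{-1}s_d$ and $\varphi_i - \varphi_i' = s_i \circ f_i + g_{i-1} \circ s_{i-1}$ for $2 \le i \le d$. The homotopy category $\mathbf{HFact}_d(\mathscr{C},S,\eta)$ has the same objects as $\mathbf{Fact}_d(\mathscr{C},S,\eta)$, and its morphisms are the homotopy classes $[\varphi]$ of morphisms. Triangulated structure on $\mathbf{HFact}_d(\mathscr{C},S,\eta)$. The suspension $\Sigma(M_i,f_i)$ is the factorization $M_2 \xrightarrow{-f_2} \cdots \xrightarrow{-f_{d-1}} M_d \xrightarrow{-f_d} SM_1 \xrightarrow{-Sf_1} SM_2$, and $\Sigma(\varphi_1,\dots,\varphi_d) = (\varphi_2,\dots,\varphi_d,S\varphi_1)$. The mapping cone $C_\varphi$ of $\varphi \colon (M_i,f_i) \to (N_i,g_i)$ is the factorization $M_2 \oplus N_1 \to M_3 \oplus N_2 \to \cdots \to SM_1 \oplus N_d \to SM_2 \oplus SN_1$ whose $i$-th map is $\left[\begin{smallmatrix}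 -f_{i+1} & 0 \\ \varphi_{i+1} & g_i \end{smallmatrix}\right]$ for $1 \le i \le d-1$ and whose $d$-th map is $\left[\begin{smallmatrix} -Sf_1 & 0 \\ S\varphi_1 & g_d \end{smallmatrix}\right]$. The morphisms $i_\varphi \colon (N_i,g_i) \to C_\varphi$ and $\pi_\varphi \colon C_\varphi \to \Sigma(M_i,f_i)$ have all components equal to $\left[\begin{smallmatrix} 0 \\ 1 \end{smallmatrix}\right]$ and $\left[\begin{smallmatrix} 1 & 0 \end{smallmatrix}\right]$, respectively. A standard triangle is $(M_i,f_i) \xrightarrow{[\varphi]} (N_i,g_i) \xrightarrow{[i_\varphi]} C_\varphi \xrightarrow{[\pi_\varphi]} \Sigma(M_i,f_i)$, and $\Delta$ is the collection of all triangles isomorphic to a standard triangle. With this structure $\mathbf{HFact}_d(\mathscr{C},S,\eta)$ is a triangulated category. Sequences and $t$-complexes. For an additive category $\mathscr{A}$, $\mathbf{HSeq}\,\mathscr{A}$ is the homotopy category of all (doubly infinite) sequences $\cdots \to A_{n+1} \xrightarrow{d_{n+1}} A_n \xrightarrow{d_n} A_{n-1} \to \cdots$ of objects and morphisms in $\mathscr{A}$ (with no condition on compositions); morphisms are homotopy equivalence classes of chain maps, where chain maps $\varphi,\varphi' \colon A \to B$ are homotopic if there are $s_n \colon A_n \to B_{n+1}$ with $\varphi_n - \varphi'_n = s_{n-1} \circ d^A_n + d^B_{n+1} \circ s_n$ for all $n$. For an even integer $t \ge 2$, $\mathbf{K}_t\,\mathscr{A}$ is the homotopy category, defined in the same way,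 of all $t$-complexes, that is, sequences in which each composition of $t$ consecutive maps is zero. Both are triangulated categories with the usual shift as suspension, $(\Sigma A)_n = A_{n-1}$ with maps $-d_{n-1}$, and distinguished triangles the triangles isomorphic to standard triangles $A \to B \to C_\varphi \to \Sigma A$, defined in terms of the usual mapping cones: $(C_\varphi)_n = A_{n-1} \oplus B_n$ with maps $\left[\begin{smallmatrix} -d^A_{n-1} & 0 \\ \varphi_{n-1} & d^B_n \end{smallmatrix}\right]$. For a ring $R$, $\mathbf{HSeq}\,R$ and $\mathbf{K}_t\,R$ denote the homotopy categories of sequences and of $t$-complexes of right $R$-modules. Conventions. $(h)_*$ denotes composition with $h$, i.e. $(h)_*(g) = h \circ g$; overlines denote induced maps on quotients. $\operatorname{Hom}_{\mathscr{C}}(M,N)$ is a right $\Gamma_M$-module by precomposition. In the doubly infinite sequences above, the factorization is extended in both directions by applying powers of $S$: for $m = qd + r$ with $1 \le r \le d$ put $M_m = S^qM_r$ and $f_m = S^qf_r$; the term corresponding to $M_m$ may be placed in degree $1-m$. ''$\eta_M$ factors through $f$'' means that $\eta_M = h \circ f$ for some $h \in \operatorname{Hom}_{\mathscr{C}}(M,SM)$. *)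

(* Defs.v *)
From HB Require Import structures.
From mathcomp Require Import all_boot all_algebra.
From mathcomp Require Import boolp.

Set Implicit Arguments.
Unset Strict Implicit.
Unset Printing Implicit Defensive.

Import GRing.Theory.
Local Open Scope ring_scope.
Local Open Scope quotient_scope.

Reserved Notation "g \c f" (at level 40, left associativity).

(* Finite biproducts are given by a zero object and chosen binary ones.      *)
Record addcat := AddCat {
  ob :> Type;
  mor : ob -> ob -> zmodType;
  idm : forall A, mor A A;
  ccomp : forall A B C, mor B C -> mor A B -> mor A C
    where "g \c f" := (ccomp g f);
  compA : forall A B C D (h : mor C D) (g : mor B C) (f : mor A B),
    h \c (g \c f) = h \c g \c f;
  comp1l : forall A B (f : mor A B), idm B \c f = f;
  comp1r : forall A B (f : mor A B), f \c idm A = f;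
  compDl : forall A B C (g g' : mor B C) (f : mor A B),
    (g + g') \c f = g \c f + g' \c f;
  compDr : forall A B C (g : mor B C) (f f' : mor A B),
    g \c (f + f') = g \c f + g \c f';
  zob : ob;
  zob_id : idm zob = 0;
  biprod : ob -> ob -> ob;
  in1 : forall A B, mor A (biprod A B);
  in2 : forall A B, mor B (biprod A B);
  pr1 : forall A B, mor (biprod A B) A;
  pr2 : forall A B, mor (biprod A B) B;
  pr1_in1 : forall A B, pr1 A B \c in1 A B = idm A;
  pr2_in2 : forall A B, pr2 A B \c in2 A B = idm B;
  pr1_in2 : forall A B, pr1 A B \c in2 A B = 0;
  pr2_in1 : forall A B, pr2 A B \c in1 A B = 0;
  in_pr : forall A B, in1 A B \c pr1 A B + in2 A B \c pr2 A B
                      = idm (biprod A B)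
}.
Arguments mor {_} _ _.
Arguments idm {_} _.
Arguments ccomp {_ _ _ _} _ _.
Arguments zob {_}.
Arguments biprod {_} _ _.
Arguments in1 {_ _ _}.
Arguments in2 {_ _ _}.
Arguments pr1 {_ _ _}.
Arguments pr2 {_ _ _}.
Notation "g \c f" := (ccomp g f).

Section AddCatTheory.
Variable C : addcat.
Implicit Types A B D : C.

Lemma comp0l A B D (f : mor A B) : (0 : mor B D) \c f = 0.
Proof. by apply: (addIr (0 \c f)); rewrite -compDl !add0r. Qed.

Lemma comp0r A B D (f : mor B D) : f \c (0 : mor A B) = 0.
Proof. by apply: (addIr (f \c 0)); rewrite -compDr !add0r. Qed.

Lemma compNl A B D (g : mor B D) (f : mor A B) : (- g) \c f = - (g \c f).
Proof. by apply: (addIr (g \c f)); rewrite -compDl !addNr comp0l. Qed.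

Lemma compNr A B D (g : mor B D) (f : mor A B) : g \c (- f) = - (g \c f).
Proof. by apply: (addIr (g \c f)); rewrite -compDr !addNr comp0r. Qed.

Lemma from_zob A (f g : mor (zob : C) A) : f = g.
Proof. by rewrite -[f]comp1r -[g]comp1r zob_id !comp0r. Qed.

Definition is_iso A B (f : mor A B) : Prop :=
  exists g : mor B A, g \c f = idm A /\ f \c g = idm B.

Definition eqhom A B (e : A = B) : mor A B :=
  let: erefl := e in idm A.

Lemma eqhom_id A (e : A = A) : eqhom e = idm A.
Proof. by rewrite (Prop_irrelevance e erefl). Qed.

Lemma eqhom_comp A B D (e : A = B) (e' : B = D) :
  eqhom e' \c eqhom e = eqhom (etrans e e').
Proof. by subst; rewrite /= comp1l. Qed.

Lemma eqhomK A B (e : A = B) (e' : B = A) : eqhom e' \c eqhom e = idm A.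
Proof. by rewrite eqhom_comp eqhom_id. Qed.

End AddCatTheory.

Record is_addfunctor (C D : addcat) (F : C -> D)
    (Fm : forall A B, mor A B -> mor (F A) (F B)) : Prop := IsAddFunctor {
  addfun_D : forall A B (f g : mor A B), Fm _ _ (f + g) = Fm _ _ f + Fm _ _ g;
  addfun_1 : forall A, Fm _ _ (idm A) = idm (F A);
  addfun_M : forall A B E (g : mor B E) (f : mor A B),
    Fm _ _ (g \c f) = Fm _ _ g \c Fm _ _ f
}.

Record addfunctor (C D : addcat) := AddFunctor {
  fob :> C -> D;
  fmap : forall A B, mor A B -> mor (fob A) (fob B);
  fmapP : is_addfunctor fmap
}.
Arguments fmap {C D} _ {A B} _.

Section FunctorTheory.
Variables (C D : addcat) (F : addfunctor C D).
Implicit Types A B E : C.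

Lemma fmapD A B (f g : mor A B) : fmap F (f + g) = fmap F f + fmap F g.
Proof. exact: addfun_D (fmapP F) _ _ _ _. Qed.
Lemma fmap1 A : fmap F (idm A) = idm (F A).
Proof. exact: addfun_1 (fmapP F) _. Qed.
Lemma fmapM A B E (g : mor B E) (f : mor A B) :
  fmap F (g \c f) = fmap F g \c fmap F f.
Proof. exact: addfun_M (fmapP F) _ _ _ _ _. Qed.
Lemma fmap0 A B : fmap F (0 : mor A B) = 0.
Proof. by apply: (addIr (fmap F 0)); rewrite -fmapD !add0r. Qed.
Lemma fmapN A B (f : mor A B) : fmap F (- f) = - fmap F f.
Proof. by apply: (addIr (fmap F f)); rewrite -fmapD !addNr fmap0. Qed.
Lemma fmap_eqhom A B (e : A = B) : fmap F (eqhom e) = eqhom (congr1 F e).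
Proof. by subst; rewrite /= fmap1. Qed.

End FunctorTheory.

Definition idfunctor (C : addcat) : addfunctor C C.
Proof. by exists id (fun A B f => f). Defined.

Definition compfunctor (C D E : addcat) (G : addfunctor D E)
  (F : addfunctor C D) : addfunctor C E.
Proof.
exists (fun A => G (F A)) (fun A B f => fmap G (fmap F f)).
by split=> *; rewrite ?fmapD ?fmap1 ?fmapM.
Defined.

Fixpoint powfunctor (C : addcat) (F : addfunctor C C) (n : nat) :
    addfunctor C C :=
  if n is n'.+1 then compfunctor (powfunctor F n') F else idfunctor C.

(* An additive automorphism S: the inverse functor is strict, i.e. both     *)
(* composites are equal to the identity functor, on objects and (along the  *)
(* object equalities) on morphisms.                                         *)
Record automorphism (C : addcat) := Automorphism {
  aut :> addfunctor C C;
  autV : addfunctor C C;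
  autK : forall A, autV (aut A) = A;
  autVK : forall A, aut (autV A) = A;
  autK_map : forall A B (f : mor A B),
    eqhom (autK B) \c fmap autV (fmap aut f) = f \c eqhom (autK A);
  autVK_map : forall A B (f : mor A B),
    eqhom (autVK B) \c fmap aut (fmap autV f) = f \c eqhom (autVK A)
}.

Section Automorphism.
Variables (C : addcat) (S : automorphism C).
Implicit Types A B : C.

(* S^-1 h, seen as a map between A = S^-1 (S A) and B = S^-1 (S B).         *)
Definition unS A B (h : mor (S A) (S B)) : mor A B :=
  eqhom (autK S B) \c fmap (autV S) h \c eqhom (esym (autK S A)).

Lemma fmapS_K A B (f : mor A B) : unS (fmap S f) = f.
Proof. by rewrite /unS autK_map -compA eqhomK comp1r. Qed.

Lemma unS_K A B (h : mor (S A) (S B)) : fmap S (unS h) = h.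
Proof.
rewrite /unS !fmapM !fmap_eqhom.
rewrite (Prop_irrelevance (congr1 _ (autK S B)) (autVK S (S B))) autVK_map.
by rewrite -compA eqhomK comp1r.
Qed.

(* spow q is S^q *)
Definition spow (q : int) : addfunctor C C :=
  match q with
  | Posz n => powfunctor S n
  | Negz n => powfunctor (autV S) n.+1
  end.

Lemma spowS q A : spow q (S A) = spow (q + 1) A.
Proof.
case: q => [n|[|n]]; last 2 first.
- by rewrite /= autK.
- rewrite (_ : Negz n.+1 + 1 = Negz n) /= ?autK //.
  by rewrite !NegzE -[n.+2]addn1 PoszD opprD addrNK.
- by rewrite -PoszD addn1.
Qed.

End Automorphism.

Definition famhom (C : addcat) (I : Type) (X Y : I -> C) : Type :=
  forall i, mor (X i) (Y i).

Section FamHom.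
Variables (C : addcat) (I : Type) (X Y : I -> C).
HB.instance Definition _ := gen_eqMixin (famhom X Y).
HB.instance Definition _ := gen_choiceMixin (famhom X Y).
Implicit Types f g h : famhom X Y.

Let zero : famhom X Y := fun=> 0.
Let opp f : famhom X Y := fun i => - f i.
Let add f g : famhom X Y := fun i => f i + g i.
Let addA : associative add.
Proof. by move=> f g h; apply: functional_extensionality_dep => i; apply: addrA. Qed.
Let addC : commutative add.
Proof. by move=> f g; apply: functional_extensionality_dep => i; apply: addrC. Qed.
Let add0 : left_id zero add.
Proof. by move=> f; apply: functional_extensionality_dep => i; apply: add0r. Qed.
Let addN : left_inverse zero opp add.
Proof. by move=> f; apply: functional_extensionality_dep => i; apply: addNr. Qed.
HB.instance Definition _ :=
  GRing.isZmodule.Build (famhom X Y) addA addC add0 addN.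
End FamHom.

Definition famcat (C : addcat) (I : Type) : addcat.
Proof.
refine (@AddCat (I -> C) (fun X Y => famhom X Y)
  (fun X i => idm (X i)) (fun X Y Z g f i => g i \c f i) _ _ _ _ _
  (fun=> zob) _ (fun X Y i => biprod (X i) (Y i))
  (fun X Y i => in1) (fun X Y i => in2)
  (fun X Y i => pr1) (fun X Y i => pr2) _ _ _ _ _);
  move=> *; apply: functional_extensionality_dep => i.
- exact: compA.
- exact: comp1l.
- exact: comp1r.
- exact: compDl.
- exact: compDr.
- exact: zob_id.
- exact: pr1_in1.
- exact: pr2_in2.
- exact: pr1_in2.
- exact: pr2_in1.
- exact: in_pr.
Defined.

Lemma eqhom_fam (C : addcat) (I : Type) (X Y : famcat C I) (e : X = Y) i :
  eqhom e i = eqhom (congr1 (fun Z : famcat C I => Z i) e).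
Proof. by subst. Qed.

(* Sequences for a twist T of D: objects X with a map X -> T X.             *)
(* - D = families (X_n) indexed by Z, T X = (X_(n-1)): the doubly infinite  *)
(*   sequences .. -> X_n -> X_(n-1) -> ..                                   *)
(* - D = C^d, T (X_1, .., X_d) = (X_2, .., X_d, S X_1): the sequences       *)
(*   X_1 -> .. -> X_d -> S X_1.                                             *)
(* In both cases, the morphisms, the homotopies, the suspension             *)
(* (X, f) |-> (T X, - T f) and the mapping cone T X (+) Y defined below are *)
(* componentwise the usual ones.                                            *)

(* untw h stands for T^-1 h, seen as a map between A = T^-1 (T A) and       *)
(* B = T^-1 (T B).                                                          *)
Record twist (D : addcat) := Twist {
  tw :> addfunctor D D;
  untw : forall A B, mor (tw A) (tw B) -> mor A B;
  fmap_twK : forall A B (f : mor A B), untw (fmap tw f) = f;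
  untwK : forall A B (f : mor (tw A) (tw B)), fmap tw (untw f) = f
}.
Arguments untw {D} _ {A B} _.

Section Twist.
Variables (D : addcat) (T : twist D).
Implicit Types X Y Z : D.

Lemma untwD X Y (f g : mor (T X) (T Y)) : untw T (f + g) = untw T f + untw T g.
Proof. by rewrite -{1}[f]untwK -{1}[g]untwK -fmapD fmap_twK. Qed.
Lemma untwN X Y (f : mor (T X) (T Y)) : untw T (- f) = - untw T f.
Proof. by rewrite -{1}[f]untwK -fmapN fmap_twK. Qed.
Lemma untw0 X Y : untw T (0 : mor (T X) (T Y)) = 0.
Proof. by rewrite -(fmap0 T) fmap_twK. Qed.
Lemma untw_compl X Y Z (g : mor Y Z) (f : mor (T X) (T Y)) :
  untw T (fmap T g \c f) = g \c untw T f.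
Proof. by rewrite -{1}[f]untwK -fmapM fmap_twK. Qed.
Lemma untw_compr X Y Z (g : mor (T Y) (T Z)) (f : mor X Y) :
  untw T (g \c fmap T f) = untw T g \c f.
Proof. by rewrite -{1}[g]untwK -fmapM fmap_twK. Qed.

(* n-fold composition T^(n-1) f \c ... \c T f \c f                          *)
Fixpoint tcomp n X (f : mor X (T X)) : mor X (iter n T X) :=
  if n is n'.+1 then fmap T (tcomp n' f) \c f else idm X.

(* The matrix [a 0; c b] : A (+) B -> T A (+) T B, where T A (+) T B is     *)
(* identified with T (A (+) B), T being additive.                           *)
Definition lower_map A B (a : mor A (T A)) (b : mor B (T B)) (c : mor A (T B)) :
    mor (biprod A B) (T (biprod A B)) :=
  fmap T in1 \c (a \c pr1) + fmap T in2 \c (c \c pr1 + b \c pr2).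

(* A class of sequences that is closed under the zero object, the shift     *)
(* (T X, - T f) and extensions, hence under finite sums and mapping cones.  *)
Record twclass := TwClass {
  twc : forall X, mor X (T X) -> Prop;
  twc_zero : twc (0 : mor zob (T zob));
  twc_shift : forall X (f : mor X (T X)), twc f -> twc (- fmap T f);
  twc_ext : forall A B (a : mor A (T A)) (b : mor B (T B)) (c : mor A (T B)),
    twc a -> twc b -> fmap T c \c a + fmap T b \c c = 0 ->
    twc (lower_map a b c)
}.

Fixpoint fiter n X Y (h : mor X Y) : mor (iter n T X) (iter n T Y) :=
  if n is n'.+1 then fmap T (fiter n' h) else h.

Lemma lower_map_in1 A B (a : mor A (T A)) (b : mor B (T B)) (c : mor A (T B)) :
  lower_map a b c \c in1 = fmap T in1 \c a + fmap T in2 \c c.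
Proof.
by rewrite /lower_map compDl -!compA compDl -!compA pr1_in1 pr2_in1 comp0r addr0 !comp1r.
Qed.

Lemma lower_map_in2 A B (a : mor A (T A)) (b : mor B (T B)) (c : mor A (T B)) :
  lower_map a b c \c in2 = fmap T in2 \c b.
Proof.
by rewrite /lower_map compDl -!compA compDl -!compA pr1_in2 pr2_in2 !comp0r !add0r comp1r.
Qed.

Lemma pr1_lower_map A B (a : mor A (T A)) (b : mor B (T B)) (c : mor A (T B)) :
  fmap T pr1 \c lower_map a b c = a \c pr1.
Proof.
by rewrite /lower_map compDr !compA -!fmapM pr1_in1 pr1_in2 fmap0 fmap1 comp1l comp0l addr0.
Qed.

Lemma pr2_lower_map A B (a : mor A (T A)) (b : mor B (T B)) (c : mor A (T B)) :
  fmap T pr2 \c lower_map a b c = c \c pr1 + b \c pr2.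
Proof.
by rewrite /lower_map compDr !compA -!fmapM pr2_in1 pr2_in2 fmap0 fmap1 comp1l !comp0l add0r.
Qed.

Lemma tcomp_double_lower k A B (a : mor A (T A)) (b : mor B (T B))
    (c : mor A (T B)) : fmap T c \c a + fmap T b \c c = 0 ->
  tcomp k.*2 (lower_map a b c) =
    fiter k.*2 in1 \c (tcomp k.*2 a \c pr1) + fiter k.*2 in2 \c (tcomp k.*2 b \c pr2).
Proof.
move=> abc; elim: k => [|k IHk] /=; first by rewrite !comp1l in_pr.
set L := lower_map a b c in IHk *.
have LL : fmap T L \c L = fmap T (fmap T in1) \c (fmap T a \c a \c pr1)
                          + fmap T (fmap T in2) \c (fmap T b \c b \c pr2).
  have E1 : fmap T L \c fmap T in1
      = fmap T (fmap T in1) \c fmap T a + fmap T (fmap T in2) \c fmap T c.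
    by rewrite -fmapM lower_map_in1 fmapD !fmapM.
  have E2 : fmap T L \c fmap T in2 = fmap T (fmap T in2) \c fmap T b.
    by rewrite -fmapM lower_map_in2 fmapM.
  rewrite {2}/L /lower_map compDr !(compA (fmap T L)) E1 E2 compDl -addrA.
  congr (_ + _); first by rewrite -!compA.
  rewrite -!compA -compDr; congr (_ \c _).
  by rewrite compDr addrA !compA -compDl abc comp0l add0r.
have tL1 : tcomp k.*2 L \c in1 = fiter k.*2 in1 \c tcomp k.*2 a.
  by rewrite IHk compDl -!compA pr1_in1 pr2_in1 !comp0r addr0 comp1r.
have tL2 : tcomp k.*2 L \c in2 = fiter k.*2 in2 \c tcomp k.*2 b.
  by rewrite IHk compDl -!compA pr1_in2 pr2_in2 !comp0r add0r comp1r.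
rewrite fmapM -[_ \c L]compA LL compDr !compA -!fmapM tL1 tL2.
by rewrite !fmapM -!compA.
Qed.

Lemma tcomp_double_opp k X (f : mor X (T X)) : tcomp k.*2 (- f) = tcomp k.*2 f.
Proof.
elim: k => //= k ->.
by rewrite !compNr fmapN compNl opprK.
Qed.

Lemma tcomp_even_lower n A B (a : mor A (T A)) (b : mor B (T B))
    (c : mor A (T B)) : ~~ odd n -> fmap T c \c a + fmap T b \c c = 0 ->
  tcomp n (lower_map a b c) =
    fiter n in1 \c (tcomp n a \c pr1) + fiter n in2 \c (tcomp n b \c pr2).
Proof. by move=> /even_halfK <-; apply: tcomp_double_lower. Qed.

Lemma tcomp_even_opp n X (f : mor X (T X)) :
  ~~ odd n -> tcomp n (- f) = tcomp n f.
Proof. by move=> /even_halfK <-; apply: tcomp_double_opp. Qed.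

Lemma tcomp_shift n X (f : mor X (T X)) (e : iter n T (T X) = T (iter n T X)) :
  eqhom e \c tcomp n (fmap T f) = fmap T (tcomp n f).
Proof.
elim: n e => [|n IHn] /= e; first by rewrite eqhom_id comp1r fmap1.
have e' : iter n T (T X) = T (iter n T X) by rewrite -iterS iterSr.
rewrite (Prop_irrelevance e (congr1 T e')) -fmap_eqhom compA -fmapM IHn.
by rewrite fmapM.
Qed.

End Twist.
Arguments twc {D T} _ {X} _.

Section TwCat.
Variables (D : addcat) (T : twist D) (P : twclass T).

Record twob := TwOb {
  tob :> D;
  tmap : mor tob (T tob);
  tobP : twc P tmap
}.

Record twhom (X Y : twob) := TwHom {
  tval : mor (X : D) (Y : D);
  tcomm : fmap T tval \c tmap X = tmap Y \c tval
}.

Lemma twhom_ext X Y (f g : twhom X Y) : tval f = tval g -> f = g.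
Proof.
case: f g => [f cf] [g cg] /= e; subst g.
by rewrite (Prop_irrelevance cf cg).
Qed.

Section TwHomZmod.
Variables X Y : twob.
HB.instance Definition _ := gen_eqMixin (twhom X Y).
HB.instance Definition _ := gen_choiceMixin (twhom X Y).

Fact twhom_zero_comm : fmap T (0 : mor (X : D) Y) \c tmap X = tmap Y \c 0.
Proof. by rewrite fmap0 comp0l comp0r. Qed.
Definition twhom_zero : twhom X Y := TwHom twhom_zero_comm.

Fact twhom_opp_comm (f : twhom X Y) :
  fmap T (- tval f) \c tmap X = tmap Y \c (- tval f).
Proof. by rewrite fmapN compNl compNr tcomm. Qed.
Definition twhom_opp f : twhom X Y := TwHom (twhom_opp_comm f).

Fact twhom_add_comm (f g : twhom X Y) :
  fmap T (tval f + tval g) \c tmap X = tmap Y \c (tval f + tval g).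
Proof. by rewrite fmapD compDl compDr !tcomm. Qed.
Definition twhom_add f g : twhom X Y := TwHom (twhom_add_comm f g).

Fact twhom_addA : associative twhom_add.
Proof. by move=> f g h; apply: twhom_ext; apply: addrA. Qed.
Fact twhom_addC : commutative twhom_add.
Proof. by move=> f g; apply: twhom_ext; apply: addrC. Qed.
Fact twhom_add0 : left_id twhom_zero twhom_add.
Proof. by move=> f; apply: twhom_ext; apply: add0r. Qed.
Fact twhom_addN : left_inverse twhom_zero twhom_opp twhom_add.
Proof. by move=> f; apply: twhom_ext; apply: addNr. Qed.
HB.instance Definition _ := GRing.isZmodule.Build (twhom X Y)
  twhom_addA twhom_addC twhom_add0 twhom_addN.
End TwHomZmod.

Fact twid_comm (X : twob) : fmap T (idm (X : D)) \c tmap X = tmap X \c idm _.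
Proof. by rewrite fmap1 comp1l comp1r. Qed.
Definition twid (X : twob) : twhom X X := TwHom (twid_comm X).

Fact twcomp_comm X Y Z (g : twhom Y Z) (f : twhom X Y) :
  fmap T (tval g \c tval f) \c tmap X = tmap Z \c (tval g \c tval f).
Proof. by rewrite fmapM -compA tcomm !compA tcomm. Qed.
Definition twcomp X Y Z (g : twhom Y Z) (f : twhom X Y) : twhom X Z :=
  TwHom (twcomp_comm g f).

Definition twzero : twob := TwOb (twc_zero P).

Fact twbiprod_subproof (X Y : twob) : twc P (lower_map (tmap X) (tmap Y) 0).
Proof.
apply: twc_ext; [exact: tobP | exact: tobP |].
by rewrite fmap0 comp0l comp0r addr0.
Qed.
Definition twbiprod (X Y : twob) : twob := TwOb (twbiprod_subproof X Y).

Fact twin1_comm (X Y : twob) :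
  fmap T in1 \c tmap X = tmap (twbiprod X Y) \c in1.
Proof. by rewrite lower_map_in1 comp0r addr0. Qed.
Definition twin1 (X Y : twob) : twhom X (twbiprod X Y) := 
  @TwHom X (twbiprod X Y) in1 (twin1_comm X Y).
Fact twin2_comm (X Y : twob) :
  fmap T in2 \c tmap Y = tmap (twbiprod X Y) \c in2.
Proof. by rewrite lower_map_in2. Qed.
Definition twin2 (X Y : twob) : twhom Y (twbiprod X Y) := 
  @TwHom Y (twbiprod X Y) in2 (twin2_comm X Y).
Fact twpr1_comm (X Y : twob) :
  fmap T pr1 \c tmap (twbiprod X Y) = tmap X \c pr1.
Proof. by rewrite pr1_lower_map. Qed.
Definition twpr1 (X Y : twob) : twhom (twbiprod X Y) X := 
  @TwHom (twbiprod X Y) X pr1 (twpr1_comm X Y).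
Fact twpr2_comm (X Y : twob) :
  fmap T pr2 \c tmap (twbiprod X Y) = tmap Y \c pr2.
Proof. by rewrite pr2_lower_map comp0l add0r. Qed.
Definition twpr2 (X Y : twob) : twhom (twbiprod X Y) Y := 
  @TwHom (twbiprod X Y) Y pr2 (twpr2_comm X Y).

Definition twcat : addcat.
Proof.
refine (@AddCat twob (fun X Y => twhom X Y) twid twcomp _ _ _ _ _
  twzero _ twbiprod twin1
  twin2 twpr1
  twpr2 _ _ _ _ _); move=> *; apply: twhom_ext.
- exact: compA.
- exact: comp1l.
- exact: comp1r.
- exact: compDl.
- exact: compDr.
- exact: zob_id.
- exact: pr1_in1.
- exact: pr2_in2.
- exact: pr1_in2.
- exact: pr2_in1.
- exact: in_pr.
Defined.

Definition homotopic (X Y : twob) (f f' : twhom X Y) : Prop :=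
  exists s : mor (T X) Y,
    tval f - tval f' = s \c tmap X + untw T (tmap Y \c s).

Definition nullh (X Y : twob) : {pred twhom X Y} :=
  fun f => `[< homotopic f 0 >].
Arguments nullh : clear implicits.

Lemma nullhP X Y (f : twhom X Y) :
  reflect (exists s : mor (T X) Y, tval f = s \c tmap X + untw T (tmap Y \c s))
          (f \in nullh X Y).
Proof.
by apply: (iffP (asboolP _)) => -[s e]; exists s; move: e; rewrite /= subr0.
Qed.

Fact nullh_zmod_closed X Y : zmod_closed (nullh X Y).
Proof.
split; first by apply/nullhP; exists 0; rewrite comp0l comp0r untw0 addr0.
move=> f g /nullhP[s es] /nullhP[t et]; apply/nullhP; exists (s - t).
rewrite /= es et compDl compDr compNl compNr untwD untwN opprD.
by rewrite addrACA.
Qed.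
HB.instance Definition _ X Y :=
  GRing.isZmodClosed.Build (twhom X Y) (nullh X Y) (nullh_zmod_closed X Y).

Lemma nullh_compl X Y Z (g : twhom Y Z) (f : twhom X Y) :
  f \in nullh X Y -> twcomp g f \in nullh X Z.
Proof.
move=> /nullhP[s es]; apply/nullhP; exists (tval g \c s).
by rewrite /= es compDr !compA -untw_compl compA tcomm.
Qed.

Lemma nullh_compr X Y Z (g : twhom Y Z) (f : twhom X Y) :
  g \in nullh Y Z -> twcomp g f \in nullh X Z.
Proof.
move=> /nullhP[s es]; apply/nullhP; exists (s \c fmap T (tval f)).
by rewrite /= es compDl compA untw_compr -!compA tcomm.
Qed.

Definition hhom (X Y : twob) : zmodType := Quotient.quot (nullh X Y).

Definition hpi X Y (f : twhom X Y) : hhom X Y := \pi_(Quotient.quot (nullh X Y)) f.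

Lemma hpi_nullh X Y (f g : twhom X Y) :
  hpi f = hpi g <-> f - g \in nullh X Y.
Proof.
have := Quotient.idealrBE (nullh X Y) f g => /= ->.
by split=> [e|/eqP]; [apply/eqP|].
Qed.

Lemma hpiP X Y (f g : twhom X Y) : hpi f = hpi g <-> homotopic f g.
Proof.
by rewrite hpi_nullh; split=> [/nullhP //|h]; apply/nullhP.
Qed.

Lemma hpi_repr X Y (p : hhom X Y) : hpi (repr p) = p.
Proof. exact: reprK. Qed.

Lemma hpiD X Y (f g : twhom X Y) : hpi (f + g) = hpi f + hpi g.
Proof. by rewrite /hpi !piE. Qed.

Definition hcomp X Y Z (q : hhom Y Z) (p : hhom X Y) : hhom X Z :=
  hpi (twcomp (repr q) (repr p)).

Lemma hcompE X Y Z (g : twhom Y Z) (f : twhom X Y) :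
  hcomp (hpi g) (hpi f) = hpi (twcomp g f).
Proof.
apply/hpi_nullh.
set g' := repr (hpi g); set f' := repr (hpi f).
have -> : twcomp g' f' - twcomp g f = twcomp g' (f' - f) + twcomp (g' - g) f.
  apply: twhom_ext => /=; rewrite compDl compDr compNl compNr.
  by rewrite addrA addrNK.
apply: rpredD; [apply: nullh_compl|apply: nullh_compr];
  by apply/hpi_nullh; exact: hpi_repr.
Qed.

Definition hcat : addcat.
Proof.
refine (@AddCat twob hhom (fun X => hpi (twid X)) hcomp _ _ _ _ _
  twzero _ twbiprod (fun X Y => hpi (twin1 X Y))
  (fun X Y => hpi (twin2 X Y))
  (fun X Y => hpi (twpr1 X Y))
  (fun X Y => hpi (twpr2 X Y)) _ _ _ _ _).
- move=> X Y Z W h g f; rewrite -[h]hpi_repr -[g]hpi_repr -[f]hpi_repr.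
  by rewrite !hcompE; congr hpi; exact: (@compA twcat).
- move=> X Y f; rewrite -[f]hpi_repr hcompE; congr hpi.
  exact: (@comp1l twcat).
- move=> X Y f; rewrite -[f]hpi_repr hcompE; congr hpi.
  exact: (@comp1r twcat).
- move=> X Y Z g g' f.
  rewrite -[g]hpi_repr -[g']hpi_repr -[f]hpi_repr -hpiD !hcompE.
  by rewrite -hpiD; congr hpi; exact: (@compDl twcat).
- move=> X Y Z g f f'.
  rewrite -[g]hpi_repr -[f']hpi_repr -[f]hpi_repr -hpiD !hcompE.
  by rewrite -hpiD; congr hpi; exact: (@compDr twcat).
- by rewrite (@zob_id twcat : twid twzero = 0) /hpi piE.
- by move=> X Y; rewrite hcompE; congr hpi; exact: (@pr1_in1 twcat).
- by move=> X Y; rewrite hcompE; congr hpi; exact: (@pr2_in2 twcat).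
- move=> X Y; rewrite hcompE (_ : twcomp _ _ = 0) /hpi ?piE //.
  exact: (@pr1_in2 twcat).
- move=> X Y; rewrite hcompE (_ : twcomp _ _ = 0) /hpi ?piE //.
  exact: (@pr2_in1 twcat).
- move=> X Y; rewrite !hcompE -hpiD; congr hpi.
  exact: (@in_pr twcat).
Defined.

Definition twsusp (X : twob) : twob := TwOb (twc_shift (tobP X)).

Fact twsusp_comm X Y (f : twhom X Y) :
  fmap T (fmap T (tval f)) \c tmap (twsusp X)
    = tmap (twsusp Y) \c fmap T (tval f).
Proof. by rewrite /= compNl compNr -!fmapM tcomm. Qed.
Definition twsusp_map X Y (f : twhom X Y) : twhom (twsusp X) (twsusp Y) :=
  @TwHom (twsusp X) (twsusp Y) (fmap T (tval f)) (twsusp_comm f).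

Definition hsusp_map X Y (p : hhom X Y) : hhom (twsusp X) (twsusp Y) :=
  hpi (twsusp_map (repr p)).

Lemma hsusp_mapE X Y (f : twhom X Y) :
  hsusp_map (hpi f) = hpi (twsusp_map f).
Proof.
apply/hpiP; have /hpiP[s es] := hpi_repr (hpi f).
exists (- fmap T s); rewrite /= !compNl !compNr !opprK -!fmapM fmap_twK.
by rewrite -fmapN -fmapD es fmapD untwK.
Qed.

Definition hsusp : addfunctor hcat hcat.
Proof.
exists twsusp hsusp_map; split.
- move=> X Y f g; rewrite -[f]hpi_repr -[g]hpi_repr -hpiD !hsusp_mapE.
  by rewrite -hpiD; congr hpi; apply: twhom_ext; rewrite /= fmapD.
- move=> X; rewrite hsusp_mapE; congr hpi.
  by apply: twhom_ext; rewrite /= fmap1.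
- move=> X Y Z g f; rewrite -[f]hpi_repr -[g]hpi_repr.
  rewrite /= hcompE !hsusp_mapE hcompE; congr hpi.
  by apply: twhom_ext; rewrite /= fmapM.
Defined.

Fact twcone_subproof (X Y : twob) (phi : twhom X Y) :
  twc P (lower_map (- fmap T (tmap X)) (tmap Y) (fmap T (tval phi))).
Proof.
apply: twc_ext; [exact: twc_shift (tobP X) | exact: tobP |].
by rewrite compNr -!fmapM tcomm addNr.
Qed.
Definition twcone X Y (phi : twhom X Y) : twob := TwOb (twcone_subproof phi).

Fact cone_in_comm X Y (phi : twhom X Y) :
  fmap T in2 \c tmap Y = tmap (twcone phi) \c in2.
Proof. by rewrite lower_map_in2. Qed.
Definition cone_in X Y (phi : twhom X Y) : twhom Y (twcone phi) :=
  @TwHom Y (twcone phi) in2 (cone_in_comm phi).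

Fact cone_pr_comm X Y (phi : twhom X Y) :
  fmap T pr1 \c tmap (twcone phi) = tmap (twsusp X) \c pr1.
Proof. by rewrite pr1_lower_map. Qed.
Definition cone_pr X Y (phi : twhom X Y) : twhom (twcone phi) (twsusp X) :=
  @TwHom (twcone phi) (twsusp X) pr1 (cone_pr_comm phi).

Definition hclass (X Y : twob) (f : twhom X Y) : mor (X : hcat) (Y : hcat) :=
  hpi f.

(* The triangles isomorphic, in the homotopy category, to a standard one    *)
(*   X' -[phi]-> Y' -> cone phi -> Sigma X'.                                *)
Definition hdist (X Y Z : hcat) (u : mor X Y) (v : mor Y Z)
    (w : mor Z (hsusp X)) : Prop :=
  exists (X' Y' : twob) (phi : twhom X' Y')
         (a : mor X (X' : hcat)) (b : mor Y (Y' : hcat))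
         (c : mor Z (twcone phi : hcat)),
    [/\ is_iso a, is_iso b & is_iso c] /\
    [/\ b \c u = hclass phi \c a,
        c \c v = hclass (cone_in phi) \c b &
        fmap hsusp a \c w = hclass (cone_pr phi) \c c].

End TwCat.

(* The data (category, suspension, distinguished triangles) underlying a    *)
(* triangulated category; triangle functors only refer to these data.       *)
Record tricat := TriCat {
  tri_cat :> addcat;
  tri_susp : addfunctor tri_cat tri_cat;
  tri_dist : forall X Y Z : tri_cat,
    mor X Y -> mor Y Z -> mor Z (tri_susp X) -> Prop
}.
Arguments tri_dist {_ X Y Z} _ _ _.

Definition htri (D : addcat) (T : twist D) (P : twclass T) : tricat :=
  @TriCat (hcat P) (hsusp P) (@hdist D T P).

Record is_triangle_functor (K L : tricat) (F : K -> L)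
    (Fm : forall X Y, mor X Y -> mor (F X) (F Y)) : Prop := IsTriangleFunctor {
  trif_addfunctor : is_addfunctor Fm;
  trif_susp :
    exists theta : forall X, mor (F (tri_susp K X)) (tri_susp L (F X)),
      [/\ forall X, is_iso (theta X),
          forall X Y (u : mor X Y),
            theta Y \c Fm _ _ (fmap (tri_susp K) u)
            = fmap (tri_susp L) (Fm _ _ u) \c theta X &
          forall X Y Z (u : mor X Y) (v : mor Y Z) (w : mor Z (tri_susp K X)),
            tri_dist u v w ->
            tri_dist (Fm _ _ u) (Fm _ _ v) (theta X \c Fm _ _ w)]
}.

Section Sequences.
Variable A : addcat.

Definition seqshift : addfunctor (famcat A int) (famcat A int).
Proof.
exists (fun X n => X (n - 1)) (fun X Y (f : famhom X Y) n => f (n - 1)).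
by split.
Defined.

Definition seq_untw (X Y : famcat A int)
    (h : mor (seqshift X) (seqshift Y)) : mor X Y :=
  fun n => ecast k (mor (X k) (Y k)) (addrK 1 n) (h (n + 1)).

Fact seq_untw_subproof (X Y : famcat A int) (h : mor (seqshift X) (seqshift Y))
    (m n : int) (e : m - 1 = n - 1) :
  ecast k (mor (X k) (Y k)) e (h m) = h n.
Proof.
have em : m = n := addIr _ e; subst m.
by rewrite (Prop_irrelevance e erefl).
Qed.

Definition seqtwist : twist (famcat A int).
Proof.
exists seqshift seq_untw => X Y h; apply: functional_extensionality_dep => n.
  by rewrite /seq_untw /=; move: (n + 1 - 1) (addrK 1 n) => m e; subst m.
exact: seq_untw_subproof.
Defined.

(* No condition on the maps: htri all_seq is HSeq A.                        *)
Definition all_seq : twclass seqtwist.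
Proof. by exists (fun _ _ => True). Defined.

(* All composites X_n -> .. -> X_(n-t) are zero: htri (tcomplex t_even) is  *)
(* K_t A.  The parity of t makes suspensions and cones t-complexes.         *)
Definition tcomplex (t : nat) (t_even : ~~ odd t) : twclass seqtwist.
Proof.
exists (fun X (f : mor X (seqtwist X)) => tcomp t f = 0).
- exact: from_zob.
- move=> X f f0; rewrite tcomp_even_opp //.
  have e : iter t seqtwist (seqtwist X) = seqtwist (iter t seqtwist X).
    by rewrite -iterS iterSr.
  rewrite -[tcomp _ _]comp1l -(eqhomK e (esym e)) -compA tcomp_shift f0.
  by rewrite fmap0 comp0r.
- move=> X Y a b c a0 b0 abc.
  by rewrite tcomp_even_lower // a0 b0 !comp0l !comp0r addr0.
Defined.

End Sequences.

(* The indices 1, .., d of d-fold sequences are 0, .., d - 1 here.          *)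

Section Cyclic.
Variables (C : addcat) (S : automorphism C) (d : nat) (d_gt0 : (0 < d)%N).
Implicit Types X Y : famcat C 'I_d.

Definition cfst : 'I_d := Ordinal d_gt0.

Definition cnext (i : 'I_d) : option 'I_d := insub i.+1.

Definition cob (X : 'I_d -> C) (o : option 'I_d) : C :=
  if o is Some j then X j else S (X cfst).

Definition cmap (X Y : 'I_d -> C) (h : famhom X Y) (o : option 'I_d) :
    mor (cob X o) (cob Y o) :=
  if o is Some j then h j else fmap S (h cfst).

Fact cmapD X Y (f g : mor X Y) o : cmap (f + g) o = cmap f o + cmap g o.
Proof. by case: o => //=; apply: fmapD. Qed.
Fact cmap1 X o : cmap (idm X) o = idm (cob X o).
Proof. by case: o => //=; apply: fmap1. Qed.
Fact cmapM X Y Z (g : mor Y Z) (f : mor X Y) o :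
  cmap (g \c f) o = cmap g o \c cmap f o.
Proof. by case: o => //=; apply: fmapM. Qed.

(* T (X_1, .., X_d) = (X_2, .., X_d, S X_1)                                 *)
Definition cycshift : addfunctor (famcat C 'I_d) (famcat C 'I_d).
Proof.
exists (fun X i => cob X (cnext i)) (fun X Y h i => cmap h (cnext i)).
split=> *; apply: functional_extensionality_dep => i.
- exact: cmapD.
- exact: cmap1.
- exact: cmapM.
Defined.

Definition cidx (o : option 'I_d) : 'I_d := odflt cfst o.

Definition cdesc (X Y : 'I_d -> C) (o : option 'I_d) :
    mor (cob X o) (cob Y o) -> mor (X (cidx o)) (Y (cidx o)) :=
  match o with
  | Some j => fun h : mor (X j) (Y j) => h
  | None => fun h : mor (S (X cfst)) (S (Y cfst)) => unS h
  end.

Fact cdescK (X Y : 'I_d -> C) (g : famhom X Y) (o : option 'I_d)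
    (k : mor (cob X o) (cob Y o)) : g (cidx o) = cdesc k -> cmap g o = k.
Proof. by case: o k => //= k ->; apply: unS_K. Qed.

Lemma cidx_cnext i : cidx (cnext i) = ordS i.
Proof.
apply: val_inj; rewrite /cnext /=; case: insubP => [j lt_d /= ->|].
  by rewrite modn_small.
rewrite -leqNgt => di; rewrite (_ : i.+1 = d) ?modnn //.
by apply/eqP; rewrite eqn_leq di ltn_ord.
Qed.

Lemma cidx_pred j : cidx (cnext (ord_pred j)) = j.
Proof. by rewrite cidx_cnext ord_predK. Qed.

(* (T^-1 h)_j is h_(j-1) for j > 1, and S^-1 h_d for j = 1.                 *)
Definition cyc_untw X Y (h : mor (cycshift X) (cycshift Y)) : mor X Y :=
  fun j => ecast i (mor (X i) (Y i)) (cidx_pred j) (cdesc (h (ord_pred j))).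

Fact cyc_untw_subproof X Y (h : mor (cycshift X) (cycshift Y)) (i k : 'I_d)
    (e : cidx (cnext k) = cidx (cnext i)) :
  ecast i (mor (X i) (Y i)) e (cdesc (h k)) = cdesc (h i).
Proof.
have ek : k = i by apply: (can_inj (@ordSK d)); rewrite -!cidx_cnext.
by subst k; rewrite (Prop_irrelevance e erefl).
Qed.

Definition cyctwist : twist (famcat C 'I_d).
Proof.
exists cycshift cyc_untw => X Y h; apply: functional_extensionality_dep => i.
  rewrite /cyc_untw /=; move: (ord_pred i) (cidx_pred i) => k e; subst i.
  by case: (cnext k) => //=; apply: fmapS_K.
have : cyc_untw h (cidx (cnext i)) = cdesc (h i) by exact: cyc_untw_subproof.
exact: cdescK.
Defined.

Local Notation T := cyctwist.

Fact cyc_iter_same k X (i j : 'I_d) : (i + k = j)%N -> iter k T X i = X j.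
Proof.
elim: k i => [|k IHk] i; first by rewrite addn0 => /val_inj ->.
rewrite addnS -addSn /= /cnext => eij.
have lt_i : (i.+1 < d)%N by rewrite (leq_ltn_trans _ (ltn_ord j)) // -eij leq_addr.
case: insubP => [i' _ ei'|/negP[] //].
by apply: IHk; rewrite ei'.
Qed.

Fact cyc_iter_next k X (i j : 'I_d) : (i + k = j + d)%N -> iter k T X i = S (X j).
Proof.
elim: k i => [|k IHk] i.
  by rewrite addn0 => e; move: (ltn_ord i); rewrite e ltnNge leq_addl.
rewrite addnS -addSn /= /cnext => eij; case: insubP => [i' _ ei'|].
  by apply: IHk; rewrite ei'.
rewrite -leqNgt => di /=; congr (S _); apply: cyc_iter_same; rewrite /= add0n.
have ei : i.+1 = d by apply/eqP; rewrite eqn_leq di ltn_ord.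
by apply/eqP; rewrite -(eqn_add2r d) -eij ei addnC.
Qed.

(* T^d X = S X                                                              *)
Lemma cyc_iter X (i : 'I_d) : iter d T X i = S (X i).
Proof. exact: cyc_iter_next. Qed.

Fact cyc_fiter_same k X Y (h : mor X Y) (i j : 'I_d) (eX : iter k T X i = X j)
    (eY : iter k T Y i = Y j) : (i + k = j)%N ->
  eqhom eY \c fiter T k h i = h j \c eqhom eX.
Proof.
elim: k i eX eY => [|k IHk] i eX eY.
  rewrite addn0 => /val_inj eij; subst j.
  by rewrite !eqhom_id comp1l comp1r.
rewrite addnS -addSn => eij.
have lt_i : (i.+1 < d)%N by rewrite (leq_ltn_trans _ (ltn_ord j)) // -eij leq_addr.
move: eX eY; rewrite /= /cnext; case: insubP => [i' _ ei' /=|/negP[] //] eX eY.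
by apply: IHk; rewrite ei'.
Qed.

Fact cyc_fiter_next k X Y (h : mor X Y) (i j : 'I_d)
    (eX : iter k T X i = S (X j)) (eY : iter k T Y i = S (Y j)) :
    (i + k = j + d)%N ->
  eqhom eY \c fiter T k h i = fmap S (h j) \c eqhom eX.
Proof.
elim: k i eX eY => [|k IHk] i eX eY.
  by rewrite addn0 => e; move: (ltn_ord i); rewrite e ltnNge leq_addl.
rewrite addnS -addSn => eij.
move: eX eY; rewrite /= /cnext; case: insubP => [i' _ ei' /=|] eX.
  by move=> *; apply: IHk; rewrite ei'.
rewrite -leqNgt in eX; move=> /= eX' eY'.
have ek : (cfst + k = j)%N.
  have ei : i.+1 = d by apply/eqP; rewrite eqn_leq eX ltn_ord.
  by rewrite /= add0n; apply/eqP; rewrite -(eqn_add2r d) -eij ei addnC.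
have gX := cyc_iter_same X ek; have gY := cyc_iter_same Y ek.
rewrite (Prop_irrelevance eX' (congr1 S gX)) (Prop_irrelevance eY' (congr1 S gY)).
by rewrite -!fmap_eqhom -!fmapM (cyc_fiter_same _ _ _ ek).
Qed.

Lemma cyc_iter_nat X Y (h : mor X Y) i :
  eqhom (cyc_iter Y i) \c fiter T d h i = fmap S (h i) \c eqhom (cyc_iter X i).
Proof. exact: cyc_fiter_next. Qed.

End Cyclic.

Section Factorization.
Variables (C : addcat) (S : automorphism C) (eta : forall A : C, mor A (S A)).
Variables (d : nat) (d_ge2 : (2 <= d)%N).

Local Notation T := (cyctwist S (ltnW d_ge2)).

(* Every d-fold composition M_i -> .. -> S M_i, namely                      *)
(* S f_(i-1) \c .. \c S f_1 \c f_d \c .. \c f_i, is eta.                    *)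
Definition is_factorization (X : famcat C 'I_d) (f : mor X (T X)) : Prop :=
  forall i, eqhom (cyc_iter S (ltnW d_ge2) X i) \c tcomp d f i = eta (X i).

Variable eta_nat : forall (A B : C) (h : mor A B),
  eta B \c h = fmap S h \c eta A.
Variable eta_S : forall A, eta (S A) = fmap S (eta A).
Variable d_even : ~~ odd d.

Fact fact_shift (X : famcat C 'I_d) (f : mor X (T X)) :
  is_factorization f -> is_factorization (- fmap T f).
Proof.
move=> fP i; rewrite tcomp_even_opp //.
have e : iter d T (T X) = T (iter d T X) by rewrite -iterS iterSr.
rewrite -[tcomp _ _]comp1l -(eqhomK e (esym e)) -compA tcomp_shift /=.
rewrite compA eqhom_fam eqhom_comp.
move: (etrans _ _) => /=; case: (cnext i) => [j|] q /=.
  by rewrite (Prop_irrelevance q (cyc_iter S (ltnW d_ge2) X j)) fP.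
set q' := cyc_iter S (ltnW d_ge2) X (cfst (ltnW d_ge2)).
by rewrite (Prop_irrelevance q (congr1 S q')) -fmap_eqhom -fmapM fP eta_S.
Qed.

Fact fact_ext (X Y : famcat C 'I_d) (a : mor X (T X)) (b : mor Y (T Y))
    (c : mor X (T Y)) : is_factorization a -> is_factorization b ->
  fmap T c \c a + fmap T b \c c = 0 -> is_factorization (lower_map a b c).
Proof.
move=> aP bP abc i; rewrite tcomp_even_lower //.
have E (Z W : famcat C 'I_d) (z : mor Z (T Z)) (h : mor Z W) B
    (p : mor B (Z i)) : is_factorization z ->
    eqhom (cyc_iter S (ltnW d_ge2) W i) \c (fiter T d h i \c (tcomp d z i \c p))
    = eta (W i) \c (h i \c p).
  by move=> zP; rewrite compA cyc_iter_nat -compA (compA (eqhom _)) zP compA -eta_nat -compA.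
rewrite [X in _ \c X](_ : _ = fiter T d in1 i \c (tcomp d a i \c pr1)
                   + fiter T d in2 i \c (tcomp d b i \c pr2)) // compDr.
by rewrite (E X) // (E Y) // -compDr in_pr comp1r.
Qed.

(* htri factorization is HFact_d (C, S, eta).                               *)
Definition factorization : twclass T.
Proof.
exists is_factorization.
- by move=> i; apply: from_zob.
- exact: fact_shift.
- exact: fact_ext.
Defined.

End Factorization.

(* A right R-module is an lmodType R^c, with x . a written a *: x.          *)

Section LinearHom.
Variables (R : pzRingType) (U V : lmodType R).
Implicit Types f g h : {linear U -> V}.

Fact linear_ext f g : f =1 g -> f = g.
Proof.
case: f g => [f cf] [g cg] /= /funext e; subst g; congr (GRing.Linear.Pack _).
case: cf cg => [[mf] [sf]] [[mg] [sg]].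
by rewrite (Prop_irrelevance mf mg) (Prop_irrelevance sf sg).
Qed.
HB.instance Definition _ := gen_eqMixin {linear U -> V}.
HB.instance Definition _ := gen_choiceMixin {linear U -> V}.

Let zero : {linear U -> V} := \0.
Let opp f : {linear U -> V} := \- f.
Let add f g : {linear U -> V} := f \+ g.
Fact lin_addA : associative add.
Proof. by move=> f g h; apply: linear_ext => x; apply: addrA. Qed.
Fact lin_addC : commutative add.
Proof. by move=> f g; apply: linear_ext => x; apply: addrC. Qed.
Fact lin_add0 : left_id zero add.
Proof. by move=> f; apply: linear_ext => x; apply: add0r. Qed.
Fact lin_addN : left_inverse zero opp add.
Proof. by move=> f; apply: linear_ext => x; apply: addNr. Qed.
HB.instance Definition _ := GRing.isZmodule.Build {linear U -> V}
  lin_addA lin_addC lin_add0 lin_addN.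
End LinearHom.

Section MkLinear.
Variables (R : pzRingType) (U V : lmodType R) (f : U -> V).
Hypothesis f_linear : forall a u v, f (a *: u + v) = a *: f u + f v.
Definition mklinear_fun : U -> V := f.
HB.instance Definition _ :=
  GRing.isLinear.Build R U V *:%R mklinear_fun f_linear.
Definition mklinear : {linear U -> V} := mklinear_fun.
End MkLinear.

Section ModCat.
Variable R : pzRingType.
Implicit Types U V W : lmodType R^c.

Definition lin_comp U V W (g : {linear V -> W}) (f : {linear U -> V}) :
  {linear U -> W} := g \o f.

Fact lin_in1_subproof U V a (u v : U) :
  (a *: u + v, 0 : V) = a *: (u, 0) + (v, 0).
Proof. by congr pair; rewrite /= scaler0 addr0. Qed.
Fact lin_in2_subproof U V a (u v : V) :
  (0 : U, a *: u + v) = a *: (0, u) + (0, v).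
Proof. by congr pair; rewrite /= scaler0 addr0. Qed.

Definition modcat : addcat.
Proof.
refine (@AddCat (lmodType R^c) (fun U V => {linear U -> V} : zmodType)
  (fun U => idfun) lin_comp _ _ _ _ _ 'rV[R^c]_0 _
  (fun U V => (U * V)%type : lmodType R^c)
  (fun U V => mklinear (@lin_in1_subproof U V))
  (fun U V => mklinear (@lin_in2_subproof U V))
  (fun U V => mklinear (f := fst) (fun a u v => erefl))
  (fun U V => mklinear (f := snd) (fun a u v => erefl)) _ _ _ _ _).
- by move=> *; apply: linear_ext.
- by move=> *; apply: linear_ext.
- by move=> *; apply: linear_ext.
- by move=> *; apply: linear_ext.
- by move=> U V W g f f'; apply: linear_ext => x; apply: linearD.
- by apply: linear_ext => x; rewrite thinmx0 /= [RHS]thinmx0.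
- by move=> *; apply: linear_ext.
- by move=> *; apply: linear_ext.
- by move=> *; apply: linear_ext.
- by move=> *; apply: linear_ext.
- move=> U V; apply: linear_ext => -[u v]; congr pair; first exact: addr0.
  exact: add0r.
Defined.

End ModCat.

Definition endr (C : addcat) (M : C) : Type := mor M M.
HB.instance Definition _ (C : addcat) (M : C) := GRing.Zmodule.on (endr M).
HB.instance Definition _ (C : addcat) (M : C) :=
  GRing.Zmodule_isPzRing.Build (endr M)
    (fun h g f => compA h g f) (fun f => comp1l f) (fun f => comp1r f)
    (fun g g' f => compDl g g' f) (fun g f f' => compDr g f f').

Definition rhom (C : addcat) (M N : C) : Type := mor M N.
HB.instance Definition _ (C : addcat) (M N : C) := GRing.Zmodule.on (rhom M N).

Section Rhom.
Variables (C : addcat) (M N : C).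

Definition rhom_scale (a : (endr M)^c) (x : rhom M N) : rhom M N :=
  (x : mor M N) \c (a : mor M M).

Fact rhom_scaleA a b x : rhom_scale a (rhom_scale b x) = rhom_scale (a * b) x.
Proof. by rewrite /rhom_scale -compA. Qed.
Fact rhom_scale1 : left_id 1 rhom_scale.
Proof. by move=> x; apply: comp1r. Qed.
Fact rhom_scaleDr : right_distributive rhom_scale +%R.
Proof. by move=> a x y; apply: compDl. Qed.
Fact rhom_scaleDl x : {morph rhom_scale^~ x : a b / a + b}.
Proof. by move=> a b; apply: compDr. Qed.
HB.instance Definition _ := GRing.Zmodule_isLmodule.Build (endr M)^c (rhom M N)
  rhom_scaleA rhom_scale1 rhom_scaleDr rhom_scaleDl.
End Rhom.

Section HomFunctor.
Variables (C : addcat) (M : C).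

Definition rhom_map_fun (N N' : C) (h : mor N N') (x : rhom M N) : rhom M N' :=
  h \c (x : mor M N).

Fact rhom_map_subproof (N N' : C) (h : mor N N') a x y :
  rhom_map_fun h (a *: x + y) = a *: rhom_map_fun h x + rhom_map_fun h y.
Proof.
rewrite /rhom_map_fun; apply: (etrans (compDr _ _ _)).
by congr (_ + _); apply: compA.
Qed.

Definition rhom_map (N N' : C) (h : mor N N') :
  {linear rhom M N -> rhom M N'} := mklinear (rhom_map_subproof h).

Definition homfunctor : addfunctor C (modcat (endr M)).
Proof.
exists (fun N => rhom M N : lmodType (endr M)^c) rhom_map.
split=> *; apply: linear_ext => x.
- exact: compDl.
- exact: comp1l.
- exact/esym/compA.
Defined.
End HomFunctor.

Section QuotientRing.
Variables (R : pzRingType) (f : R).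

(* f being central below, this is the two-sided ideal generated by f        *)
Definition pideal : {pred R} := fun x => `[< exists a, x = a * f >].

Fact pideal_zmod_closed : zmod_closed pideal.
Proof.
split; first by apply/asboolP; exists 0; rewrite mul0r.
move=> _ _ /asboolP[a ->] /asboolP[b ->]; apply/asboolP.
by exists (a - b); rewrite mulrBl.
Qed.
HB.instance Definition _ := GRing.isZmodClosed.Build R pideal pideal_zmod_closed.

Variable f_central : forall g : R, GRing.comm f g.

Definition qring (fC : forall g : R, GRing.comm f g) : Type :=
  Quotient.quot pideal.
HB.instance Definition _ fC := GRing.Zmodule.on (qring fC).

Local Notation Q := (qring f_central).

Definition qproj (x : R) : Q := \pi_(Quotient.quot pideal) x.

Lemma qprojP x y : qproj x = qproj y <-> x - y \in pideal.
Proof.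
have := Quotient.idealrBE pideal x y => /= ->.
by split=> [e|/eqP]; [apply/eqP|].
Qed.

Lemma qproj_repr (p : Q) : qproj (repr p) = p.
Proof. exact: reprK. Qed.

Lemma qprojD x y : qproj (x + y) = qproj x + qproj y.
Proof. by rewrite /qproj !piE. Qed.

Definition qmul (p q : Q) : Q := qproj (repr p * repr q).

Lemma qmulE x y : qmul (qproj x) (qproj y) = qproj (x * y).
Proof.
apply/qprojP; set x' := repr (qproj x); set y' := repr (qproj y).
have /qprojP/asboolP[a ea] : qproj x' = qproj x by exact: qproj_repr.
have /qprojP/asboolP[b eb] : qproj y' = qproj y by exact: qproj_repr.
apply/asboolP; exists (x' * b + a * y).
rewrite mulrDl -mulrA -eb -(mulrA a) -(f_central y) mulrA -ea.
by rewrite mulrBr mulrBl addrA addrNK.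
Qed.

Fact qmulA : associative qmul.
Proof.
move=> p q r; rewrite -[p]qproj_repr -[q]qproj_repr -[r]qproj_repr.
by rewrite !qmulE mulrA.
Qed.
Fact qmul1 : left_id (qproj 1) qmul.
Proof. by move=> p; rewrite -[p]qproj_repr qmulE mul1r. Qed.
Fact qmulr1 : right_id (qproj 1) qmul.
Proof. by move=> p; rewrite -[p]qproj_repr qmulE mulr1. Qed.
Fact qmulDl : left_distributive qmul +%R.
Proof.
move=> p q r; rewrite -[p]qproj_repr -[q]qproj_repr -[r]qproj_repr.
by rewrite -qprojD !qmulE -qprojD mulrDl.
Qed.
Fact qmulDr : right_distributive qmul +%R.
Proof.
move=> p q r; rewrite -[p]qproj_repr -[q]qproj_repr -[r]qproj_repr.
by rewrite -qprojD !qmulE -qprojD mulrDr.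
Qed.
HB.instance Definition _ := GRing.Zmodule_isPzRing.Build Q
  qmulA qmul1 qmulr1 qmulDl qmulDr.

(* the subgroup N f of the right module N                                   *)
Definition modf (N : lmodType R^c) : {pred N} :=
  fun x => `[< exists y : N, x = (f : R^c) *: y >].
Arguments modf : clear implicits.

Fact modf_zmod_closed N : zmod_closed (modf N).
Proof.
split; first by apply/asboolP; exists 0; rewrite scaler0.
move=> _ _ /asboolP[y ->] /asboolP[z ->]; apply/asboolP.
by exists (y - z); rewrite scalerBr.
Qed.
HB.instance Definition _ (N : lmodType R^c) :=
  GRing.isZmodClosed.Build N (modf N) (modf_zmod_closed N).

Definition qmod (fC : forall g : R, GRing.comm f g) (N : lmodType R^c) : Type :=
  Quotient.quot (modf N).
HB.instance Definition _ fC N := GRing.Zmodule.on (qmod fC N).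

Section QMod.
Variable N : lmodType R^c.
Local Notation NQ := (qmod f_central N).

Definition mproj (x : N) : NQ := \pi_(Quotient.quot (modf N)) x.

Lemma mprojP x y : mproj x = mproj y <-> x - y \in modf N.
Proof.
have := Quotient.idealrBE (modf N) x y => /= ->.
by split=> [e|/eqP]; [apply/eqP|].
Qed.

Lemma mproj_repr (x : NQ) : mproj (repr x) = x.
Proof. exact: reprK. Qed.

Lemma mprojD x y : mproj (x + y) = mproj x + mproj y.
Proof. by rewrite /mproj !piE. Qed.

Definition qscale (p : Q^c) (x : NQ) : NQ :=
  mproj ((repr (p : Q) : R^c) *: repr x).

Lemma qscaleE (a : R) (x : N) :
  qscale (qproj a) (mproj x) = mproj ((a : R^c) *: x).
Proof.
apply/mprojP; set a' := repr (qproj a); set x' := repr (mproj x).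
have /qprojP/asboolP[b eb] : qproj a' = qproj a by exact: qproj_repr.
have /mprojP/asboolP[y ey] : mproj x' = mproj x by exact: mproj_repr.
apply/asboolP; exists ((a' : R^c) *: y + (b : R^c) *: x).
rewrite scalerDr !scalerA.
have -> : (f : R^c) * (b : R^c) = (a' : R^c) - (a : R^c) by rewrite eb.
have -> : (f : R^c) * (a' : R^c) = (a' : R^c) * (f : R^c).
  exact: (esym (f_central a')).
by rewrite -scalerA -ey scalerBr scalerBl addrA addrNK.
Qed.

Fact qscaleA p q x : qscale p (qscale q x) = qscale (p * q) x.
Proof.
have E (u v : R) : (qproj u : Q^c) * (qproj v : Q^c) = qproj (v * u).
  exact: qmulE.
rewrite -[x]mproj_repr -[p]qproj_repr -[q]qproj_repr.
by rewrite E !qscaleE scalerA.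
Qed.
Fact qscale1 : left_id 1 qscale.
Proof. by move=> x; rewrite -[x]mproj_repr qscaleE scale1r. Qed.
Fact qscaleDr : right_distributive qscale +%R.
Proof.
move=> p x y; rewrite -[x]mproj_repr -[y]mproj_repr -[p]qproj_repr.
by rewrite -mprojD !qscaleE -mprojD scalerDr.
Qed.
Fact qscaleDl x : {morph qscale^~ x : p q / p + q}.
Proof.
move=> p q; rewrite -[x]mproj_repr -[p]qproj_repr -[q]qproj_repr.
by rewrite -qprojD !qscaleE -mprojD scalerDl.
Qed.
HB.instance Definition _ := GRing.Zmodule_isLmodule.Build Q^c NQ
  qscaleA qscale1 qscaleDr qscaleDl.

End QMod.

Section QMap.
Variables (N N' : lmodType R^c) (h : {linear N -> N'}).

Definition qmap_fun (x : qmod f_central N) : qmod f_central N' :=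
  mproj (h (repr x)).

Lemma qmapE (x : N) : qmap_fun (mproj x) = mproj (h x).
Proof.
apply/mprojP; have /mprojP/asboolP[y ey] := mproj_repr (mproj x).
by apply/asboolP; exists (h y); rewrite -linearB ey linearZ.
Qed.

Fact qmap_subproof (p : Q^c) (x y : qmod f_central N) :
  qmap_fun (p *: x + y) = p *: qmap_fun x + qmap_fun y.
Proof.
rewrite -[p]qproj_repr -[x]mproj_repr -[y]mproj_repr.
rewrite [_ *: mproj _]qscaleE -mprojD !qmapE linearP mprojD.
by rewrite [_ *: mproj _]qscaleE.
Qed.

Definition qmap : {linear qmod f_central N -> qmod f_central N'} :=
  mklinear qmap_subproof.
End QMap.

(* N |-> N/Nf; it is - (x)_R R/(f), see is_tensor below                     *)
Definition qfunctor : addfunctor (modcat R) (modcat Q).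
Proof.
exists (fun N => qmod f_central N : lmodType Q^c) qmap.
split.
- move=> N N' h h'; apply: linear_ext => x; rewrite -[x]mproj_repr.
  by rewrite /= /mklinear_fun [LHS]qmapE [RHS]/= /mklinear_fun !qmapE -mprojD.
- by move=> N; apply: linear_ext => x; rewrite -[x]mproj_repr [LHS]qmapE.
- move=> N N' N'' h h'; apply: linear_ext => x; rewrite -[x]mproj_repr.
  by rewrite [LHS]qmapE /= /mklinear_fun !qmapE.
Defined.

End QuotientRing.

(* beta : N x Q -> P, (x, q) |-> x (x) q, is a tensor product of the right  *)
(* R-module N with Q over R, where p : R -> Q is a ring morphism; the right *)
(* Q-module structure of P is the one given by that of Q.                   *)
Definition balanced (R Q : pzRingType) (p : R -> Q) (N : lmodType R^c)
    (Z : zmodType) (g : N -> Q -> Z) : Prop :=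
  [/\ forall x y q, g (x + y) q = g x q + g y q,
      forall x q r, g x (q + r) = g x q + g x r &
      forall x (a : R) q, g ((a : R^c) *: x) q = g x (p a * q)].

Record is_tensor (R Q : pzRingType) (p : R -> Q) (N : lmodType R^c)
    (P : lmodType Q^c) (beta : N -> Q -> P) : Prop := IsTensor {
  tensor_balanced : balanced p beta;
  tensor_linear : forall x (q r : Q), beta x (q * r) = (r : Q^c) *: beta x q;
  tensor_univ : forall (Z : zmodType) (g : N -> Q -> Z), balanced p g ->
    exists! u : P -> Z,
      {morph u : y z / y + z} /\ forall x q, g x q = u (beta x q)
}.

(* x (x) q |-> x . q in N/Nf                                                *)
Definition qtensor (R : pzRingType) (f : R)
    (f_central : forall g : R, GRing.comm f g) (N : lmodType R^c)
    (x : N) (q : qring f_central) : qmod f_central N :=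
  (q : (qring f_central)^c) *: mproj f_central x.

Section FactSeq.
Variables (C : addcat) (S : automorphism C) (d : nat) (d_gt0 : (0 < d)%N).
Local Notation T := (cyctwist S d_gt0).
Implicit Types X Y : famcat C 'I_d.

Fact zrem_subproof (m : int) : (`|(m %% d)%Z| < d)%N.
Proof.
rewrite -ltz_nat gez0_abs ?modz_ge0 ?ltz_pmod //.
by rewrite -lt0n.
Qed.
Definition zrem (m : int) : 'I_d := Ordinal (zrem_subproof m).

(* S^q X_r for m = q d + r with 0 <= r < d                                  *)
Definition ext_ob (X : 'I_d -> C) (m : int) : C :=
  spow S (m %/ d)%Z (X (zrem m)).

Fact ext_next X (m m' : int) : m' = m + 1 ->
  spow S (m %/ d)%Z (T X (zrem m)) = ext_ob X m'.
Proof.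
move=> -> /=; rewrite /ext_ob /cnext.
have d0 : d%:Z != 0 by rewrite eqz_nat -lt0n.
have em := divz_eq m d; set q := (m %/ d)%Z in em *.
have er : (m %% d)%Z = zrem m by rewrite /= gez0_abs // modz_ge0.
rewrite er in em.
case: insubP => [j lt_d ej|] /=.
  have e1 : m + 1 = q * d%:Z + j%:Z by rewrite ej {1}em -addrA -PoszD addn1.
  have -> : ((m + 1) %/ d)%Z = q.
    by rewrite e1 divzMDl // divz_small ?addr0 //= ltz_nat ltn_ord.
  congr (spow S q (X _)); apply: val_inj => /=.
  by rewrite e1 modzMDl modz_small //= ltz_nat ltn_ord.
rewrite -leqNgt => ge_d.
have ed : (zrem m).+1 = d by apply/eqP; rewrite eqn_leq ge_d ltn_ord.
have e1 : m + 1 = (q + 1) * d%:Z + 0.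
  by rewrite {1}em -addrA -PoszD addn1 ed mulrDl mul1r addr0.
have -> : ((m + 1) %/ d)%Z = q + 1.
  by rewrite e1 divzMDl // div0z addr0.
rewrite spowS; congr (spow S _ (X _)); apply: val_inj => /=.
by rewrite e1 modzMDl mod0z.
Qed.

Variables (A : addcat) (G : addfunctor C A).

(* The term M_m, which is ext_ob X (m - 1) as indices start at 0 here, is   *)
(* placed in degree 1 - m; in that degree the map is S^q f_r.               *)
Definition factseq (X : famcat C 'I_d) : famcat A int :=
  fun n => G (ext_ob X (- n)).

Fact factseq_degree (n : int) : - (n - 1) = - n + 1.
Proof. by rewrite opprB addrC. Qed.

Definition factseq_map X (f : mor X (T X)) :
    mor (factseq X) (seqtwist A (factseq X)) :=
  fun n => fmap G (eqhom (ext_next X (factseq_degree n))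
                   \c fmap (spow S (- n %/ d)%Z) (f (zrem (- n)))).

Definition factseq_hom X Y (phi : mor X Y) : mor (factseq X) (factseq Y) :=
  fun n => fmap G (fmap (spow S (- n %/ d)%Z) (phi (zrem (- n)))).

(* G induces a triangle functor that sends a factorization (X, f) to        *)
(* (factseq X, factseq_map f), and [phi] to [factseq_hom phi].              *)
Definition induces_triangle_functor (P : twclass T) (Q : twclass (seqtwist A)) :
    Prop :=
  exists obQ : forall X : twob P, twc Q (factseq_map (tmap X)),
  let F (X : twob P) : twob Q := TwOb (obQ X) in
  exists chain : forall (X Y : twob P) (phi : twhom X Y),
    fmap (seqtwist A) (factseq_hom (tval phi)) \c tmap (F X)
    = tmap (F Y) \c factseq_hom (tval phi),
  exists Fm : forall X Y : htri P, mor X Y -> mor (F X : htri Q) (F Y),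
    (forall (X Y : twob P) (phi : twhom X Y),
       Fm X Y (hclass phi) = hclass (@TwHom _ _ Q (F X) (F Y) _ (chain X Y phi)))
    /\ is_triangle_functor Fm.

End FactSeq.

(* Main.v *)
From mathcomp Require Import all_boot all_algebra.
From mathcomp Require Import boolp.
Require Import Defs.

(** Factorizations and doubly infinite sequences are both objects [X] of an
    additive category [D] with a map [X -> T X], for an additive endofunctor
    [T] of [D] that is bijective on morphisms, and the homotopies, suspensions and cones on both sides are given by
    the same formulas in [T].  So a triangle functor between the two arises
    from any additive functor [H : D -> E] that comes with a natural
    isomorphism [gam : H T ~ U H] between the twists: [(X, f)] is sent to
    [(H X, gam X \c H f)].  Homotopies are transported by [H] and the inverse
    of [gam], the map [gam X] itself is the isomorphism from the image of the
    suspension to the suspension of the image, and because [H] preserves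
    biproducts the image of a cone is isomorphic to the cone of the image
    ([lift_triangle_functor]).

    Unrolling a factorization into the sequence of all [S^q M_r] and applying
    an additive functor [G] termwise is such an [H]; here [gam] consists of the
    identifications [S^q (T X)_r = M_(m+1)], natural because [S^q S = S^(q+1)]
    as functors, negative [q] included ([spowS_nat], [ext_next_nat],
    [factseq_triangle_functor]).  For [G = Hom(M, -)] this is the first claim.

    For the second claim it remains to see that the sequences obtained are
    [d]-complexes.  Their [d]-fold composites are images under [G] of
    [S^q eta], which agrees with [eta] at [S^q M_r] because [eta] commutes with
    [S], hence also with its inverse ([autV_eta], [spow_eta]).  Now if
    [eta M = h \c f], then for [x : M -> N] naturality yields
    [eta N \c x = S x \c h \c f], an element of [Hom(M, S N) f], so that
    [Hom(M, -) / Hom(M, -) f] kills every [eta N] ([hom_mod_eta]).  That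
    [N/Nf] is the tensor product of [N] with [R/(f)] is [qtensor_is_tensor]. *)

Set Implicit Arguments.
Unset Strict Implicit.
Unset Printing Implicit Defensive.

(** * Isomorphisms and homotopy classes *)

Section Isomorphisms.

Lemma is_iso_comp (C : addcat) (A B D : C) (g : mor B D) (f : mor A B) :
  is_iso g -> is_iso f -> is_iso (g \c f).
Proof.
move=> [g' [g'g gg']] [f' [f'f ff']]; exists (f' \c g'); split.
  by rewrite compA -(compA f') g'g comp1r.
by rewrite compA -(compA g) ff' comp1r.
Qed.

Lemma is_iso_fmap (C D : addcat) (F : C -> D)
    (Fm : forall A B, mor A B -> mor (F A) (F B)) (A B : C) (f : mor A B) :
  is_addfunctor Fm -> is_iso f -> is_iso (Fm _ _ f).
Proof.
move=> FP [g [gf fg]]; exists (Fm _ _ g).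
by rewrite -!(addfun_M FP) gf fg !(addfun_1 FP).
Qed.

Lemma is_iso_eqhom (C : addcat) (A B : C) (e : A = B) : is_iso (eqhom e).
Proof. by exists (eqhom (esym e)); rewrite !eqhomK. Qed.

Lemma is_iso_fam (C : addcat) (I : Type) (X Y : famcat C I) (f : mor X Y) :
  (forall i, is_iso (f i)) -> is_iso f.
Proof.
move=> fP; exists (fun i => projT1 (cid (fP i))).
by split; apply: functional_extensionality_dep => i; case: (projT2 (cid (fP i))).
Qed.

End Isomorphisms.

Section HomotopyClasses.
Variables (D : addcat) (T : twist D) (P : twclass T).

Lemma hclass_surj (X Y : htri P) (u : mor X Y) :
  exists f : twhom X Y, u = hclass f.
Proof. by exists (repr u); rewrite [RHS]hpi_repr. Qed.

Lemma hclassM (X Y Z : twob P) (g : twhom Y Z) (f : twhom X Y) :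
  hclass g \c hclass f = hclass (twcomp g f).
Proof. exact: hcompE. Qed.

Lemma hclass_susp (X Y : twob P) (f : twhom X Y) :
  fmap (tri_susp (htri P)) (hclass f) = hclass (twsusp_map f).
Proof. exact: hsusp_mapE. Qed.

(** The inverse of an isomorphism commutes with whatever the isomorphism
    commutes with, so it is again a morphism of sequences. *)
Lemma is_iso_hclass (X Y : twob P) (f : twhom X Y) :
  is_iso (tval f) -> is_iso (hclass f).
Proof.
move=> [g [gf fg]].
have gP : fmap T g \c tmap Y = tmap X \c g.
  rewrite -[tmap Y]comp1r -fg !compA -(compA _ (tmap Y)) -tcomm compA -fmapM gf.
  by rewrite fmap1 comp1l.
exists (hclass (TwHom gP)).
by split; rewrite hclassM; congr hpi; apply: twhom_ext.
Qed.

End HomotopyClasses.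

(** * The triangle functor of a twist-compatible additive functor *)

Section LiftedFunctor.
Import GRing.Theory.
Local Open Scope ring_scope.

Variables (D E : addcat) (T : twist D) (U : twist E).
Variables (P : twclass T) (Q : twclass U) (H : addfunctor D E).
Variable gam : forall X : D, mor (H (T X)) (U (H X)).
Hypothesis gam_nat : forall (X Y : D) (h : mor X Y),
  gam Y \c fmap H (fmap T h) = fmap U (fmap H h) \c gam X.
Hypothesis gam_iso : forall X, is_iso (gam X).
Variable Hmap : forall X : D, mor X (T X) -> mor (H X) (U (H X)).
Hypothesis HmapE : forall X (f : mor X (T X)), Hmap f = gam X \c fmap H f.

(** By naturality all the factors [gam] can be moved to the left of the images
    under [H].  Their product is left unspecified: the lemma serves to deduce
    that the composite on the left vanishes. *)
Lemma tcomp_lift n (X : D) (f : mor X (T X)) :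
  exists g : mor (H (iter n T X)) (iter n U (H X)),
    tcomp n (Hmap f) = g \c fmap H (tcomp n f).
Proof.
elim: n => [|n [g IHn]] /=; first by exists (idm _); rewrite fmap1 comp1l.
exists (fmap U g \c gam _).
by rewrite IHn HmapE !fmapM -!compA (compA (gam _)) gam_nat -!compA.
Qed.

Hypothesis obQ : forall X : twob P, twc Q (Hmap (tmap X)).
Let F (X : twob P) : twob Q := TwOb (obQ X).

Lemma lift_comm (X Y : twob P) (phi : twhom X Y) :
  fmap U (fmap H (tval phi)) \c tmap (F X) = tmap (F Y) \c fmap H (tval phi).
Proof. by rewrite /= !HmapE compA -gam_nat -!compA -!fmapM tcomm. Qed.

Definition lift_twhom (X Y : twob P) (phi : twhom X Y) : twhom (F X) (F Y) :=
  @TwHom _ _ Q (F X) (F Y) _ (lift_comm phi).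

Definition lift_hhom (X Y : htri P) (p : mor X Y) : mor (F X : htri Q) (F Y) :=
  hpi (lift_twhom (repr p)).

(** A homotopy [s : T X -> Y] is carried to [H s] precomposed with the
    inverse of [gam X]. *)
Lemma lift_hhomE (X Y : twob P) (phi : twhom X Y) :
  @lift_hhom X Y (hclass phi) = hclass (lift_twhom phi).
Proof.
apply/hpiP; have /hpiP[s es] := hpi_repr (hpi phi).
have [g [ggam gamg]] := gam_iso X.
exists (fmap H s \c g).
rewrite /= -fmapN -fmapD es fmapD !HmapE -compA (compA g) ggam comp1l fmapM.
congr (_ + _); rewrite -[LHS](fmap_twK U) ; congr (untw U _).
rewrite -[LHS]comp1r -gamg compA -gam_nat untwK fmapM.
by rewrite !compA.
Qed.

Lemma lift_addfunctor : is_addfunctor lift_hhom.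
Proof.
split.
- move=> X Y p q; have [f ->] := hclass_surj p; have [g ->] := hclass_surj q.
  rewrite -[_ + _]hpiD !lift_hhomE -[RHS]hpiD; congr hpi; apply: twhom_ext.
  exact: fmapD.
- move=> X; rewrite [LHS]lift_hhomE; congr hpi; apply: twhom_ext; exact: fmap1.
- move=> X Y Z q p; have [f ->] := hclass_surj p; have [g ->] := hclass_surj q.
  rewrite hclassM !lift_hhomE hclassM; congr hpi; apply: twhom_ext.
  exact: fmapM.
Qed.

Lemma lift_susp_comm (X : twob P) :
  fmap U (gam X) \c tmap (F (twsusp X)) = tmap (twsusp (F X)) \c gam X.
Proof.
by rewrite /= !HmapE fmapN !compNr gam_nat compA -fmapM compNl.
Qed.

Definition lift_susp (X : twob P) : twhom (F (twsusp X)) (twsusp (F X)) :=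
  @TwHom _ _ Q (F (twsusp X)) (twsusp (F X)) _ (lift_susp_comm X).

(** The additive functor [H] turns [T X (+) Y] into a biproduct of [H (T X)]
    and [H Y]; followed by [gam X] on the first summand, this comparison map
    goes from the image of the cone to the cone of the image. *)
Definition cone_map (X Y : D) :
    mor (H (biprod (T X) Y)) (biprod (U (H X)) (H Y)) :=
  in1 \c (gam X \c fmap H pr1) + in2 \c fmap H pr2.

Lemma cone_map_iso X Y : is_iso (cone_map X Y).
Proof.
have [g [ggam gamg]] := gam_iso X.
exists (fmap H in1 \c (g \c pr1) + fmap H in2 \c pr2); split.
  rewrite /cone_map compDl !compDr -!compA.
  rewrite !(compA pr1) !(compA pr2) pr1_in1 pr2_in2 pr1_in2 pr2_in1.
  rewrite !comp0l !comp0r !comp1l addr0 add0r (compA g) ggam comp1l.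
  by rewrite -!fmapM -fmapD in_pr fmap1.
rewrite /cone_map compDl !compDr -!compA.
rewrite !(compA (fmap H pr1)) !(compA (fmap H pr2)) -!fmapM.
rewrite pr1_in1 pr2_in2 pr1_in2 pr2_in1 !fmap1 !fmap0.
by rewrite !comp0l !comp0r !comp1l addr0 add0r (compA _ g) gamg comp1l in_pr.
Qed.

Lemma pr1_cone_map X Y : pr1 \c cone_map X Y = gam X \c fmap H pr1.
Proof.
by rewrite compDr !(compA pr1) pr1_in1 pr1_in2 comp1l comp0l addr0.
Qed.

Lemma pr2_cone_map X Y : pr2 \c cone_map X Y = fmap H pr2.
Proof.
by rewrite compDr !(compA pr2) pr2_in1 pr2_in2 comp1l comp0l add0r.
Qed.

Lemma cone_map_in2 X Y : cone_map X Y \c fmap H in2 = in2.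
Proof.
rewrite compDl -!compA -!fmapM pr1_in2 pr2_in2 fmap0 fmap1.
by rewrite !comp0r comp1r add0r.
Qed.

Lemma fmap_biprod_ext A X Y (f g : mor A (U (biprod X Y))) :
  fmap U pr1 \c f = fmap U pr1 \c g -> fmap U pr2 \c f = fmap U pr2 \c g ->
  f = g.
Proof.
move=> e1 e2; rewrite -[f]comp1l -[g]comp1l -fmap1 -in_pr fmapD !fmapM.
by rewrite !compDl -!compA e1 e2.
Qed.

Lemma lift_cone_comm (X Y : twob P) (phi : twhom X Y) :
  fmap U (cone_map X Y) \c tmap (F (twcone phi))
  = tmap (twcone (lift_twhom phi)) \c cone_map X Y.
Proof.
rewrite /= HmapE; apply: fmap_biprod_ext; rewrite !compA -!fmapM.
- rewrite pr1_cone_map pr1_lower_map fmapM -!compA pr1_cone_map.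
  rewrite (compA _ (gam _)) -gam_nat -!compA -fmapM pr1_lower_map.
  rewrite HmapE !compNl fmapN !compNr !fmapM -!compA.
  by rewrite (compA (gam (T X))) gam_nat -!compA.
- rewrite pr2_cone_map pr2_lower_map compDl -!compA pr1_cone_map pr2_cone_map.
  rewrite !compA -gam_nat -compA -fmapM pr2_lower_map fmapD compDr HmapE.
  by rewrite !fmapM !compA -gam_nat.
Qed.

Definition lift_cone (X Y : twob P) (phi : twhom X Y) :
    twhom (F (twcone phi)) (twcone (lift_twhom phi)) :=
  @TwHom _ _ Q (F (twcone phi)) (twcone (lift_twhom phi)) _ (lift_cone_comm phi).

Lemma lift_susp_nat (X Y : htri P) (u : mor X Y) :
  hclass (lift_susp Y) \c lift_hhom (fmap (tri_susp (htri P)) u)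
  = fmap (tri_susp (htri Q)) (lift_hhom u) \c hclass (lift_susp X).
Proof.
have [f ->] := hclass_surj u; rewrite hclass_susp !lift_hhomE hclass_susp.
rewrite [LHS]hclassM [RHS]hclassM; congr hpi; apply: twhom_ext; exact: gam_nat.
Qed.

(** The isomorphism [lift_susp] and the comparison [cone_map] of cones turn the
    image of a standard triangle into the standard triangle of the image. *)
Lemma lift_dist (X Y Z : htri P) (u : mor X Y) (v : mor Y Z)
    (w : mor Z (tri_susp (htri P) X)) :
  tri_dist u v w ->
  @tri_dist (htri Q) _ _ _ (lift_hhom u) (lift_hhom v)
    (hclass (lift_susp X) \c lift_hhom w).
Proof.
move=> [X' [Y' [phi [a [b [c [[ia ib ic] [eu ev ew]]]]]]]].
have FP := lift_addfunctor.
exists (F X'), (F Y'), (lift_twhom phi), (lift_hhom a), (lift_hhom b).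
exists (hclass (lift_cone phi) \c lift_hhom c).
split; first split.
- exact: is_iso_fmap FP ia.
- exact: is_iso_fmap FP ib.
- apply: is_iso_comp (is_iso_fmap FP ic).
  by apply: is_iso_hclass; apply: cone_map_iso.
split.
- by rewrite -!(addfun_M FP) eu (addfun_M FP) lift_hhomE.
- rewrite -compA -(addfun_M FP) ev (addfun_M FP) compA; congr (_ \c _).
  rewrite lift_hhomE [LHS]hclassM; congr hpi; apply: twhom_ext.
  exact: cone_map_in2.
- rewrite [LHS]compA [X in X \c _](esym (lift_susp_nat a)) -[LHS]compA.
  rewrite -(addfun_M FP) [X in lift_hhom X]ew (addfun_M FP) [LHS]compA.
  rewrite [RHS]compA; congr (_ \c _).
  rewrite lift_hhomE [LHS]hclassM [RHS]hclassM; congr hpi.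
  by apply: twhom_ext; rewrite /= pr1_cone_map.
Qed.

Lemma lift_triangle_functor : is_triangle_functor lift_hhom.
Proof.
split; first exact: lift_addfunctor.
exists (fun X => hclass (lift_susp X)); split.
- by move=> X; apply: is_iso_hclass; apply: gam_iso.
- exact: lift_susp_nat.
- exact: lift_dist.
Qed.

End LiftedFunctor.

(** * Powers of the automorphism *)

Section Powers.
Import GRing.Theory.
Local Open Scope ring_scope.
Variables (C : addcat) (S : automorphism C).

Lemma eqhom_irr (A B : C) (e e' : A = B) : eqhom e = eqhom e'.
Proof. by rewrite (Prop_irrelevance e e'). Qed.

(** For negative [q] this says that one factor of the inverse of [S] cancels
    against [S], on maps as well as on objects. *)
Lemma spowS_nat (q q' : int) (A B : C) (h : mor A B) :
    q' = q + 1 ->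
  forall (eA : spow S q (S A) = spow S q' A) (eB : spow S q (S B) = spow S q' B),
  eqhom eB \c fmap (spow S q) (fmap S h) = fmap (spow S q') h \c eqhom eA.
Proof.
move=> ->; case: q => [n|[|n]] eA eB.
- move: eA eB; rewrite -PoszD addn1 => eA eB /=.
  by rewrite !eqhom_id comp1l comp1r.
- rewrite /= (eqhom_irr eA (autK S A)) (eqhom_irr eB (autK S B)).
  exact: autK_map.
have en : Negz n.+1 + 1 = Negz n.
  by rewrite !NegzE -[n.+2]addn1 PoszD opprD addrNK.
move: eA eB; rewrite en => eA eB.
pose V : addfunctor C C := powfunctor (autV S) n.+1.
rewrite (eqhom_irr eA (congr1 V (autK S A))) (eqhom_irr eB (congr1 V (autK S B))).
have := congr1 (fun g => fmap V g) (autK_map S h).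
by rewrite [in LHS]fmapM [in RHS]fmapM !(fmap_eqhom V).
Qed.

Variable eta : forall A : C, mor A (S A).
Hypothesis eta_nat : forall (A B : C) (h : mor A B), eta B \c h = fmap S h \c eta A.
Hypothesis eta_S : forall A : C, eta (S A) = fmap S (eta A).

(** Since [fmap S] is injective, this can be checked after applying [S]; there
    it follows from [eta_S] at [autV S A] and the naturality of [eta] along the
    equality [S (autV S A) = A]. *)
Lemma autV_eta (A : C) :
  exists e : S (autV S A) = autV S (S A), fmap (autV S) (eta A) = eqhom e \c eta _.
Proof.
exists (etrans (autVK S A) (esym (autK S A))).
rewrite -eqhom_comp -compA.
suff <- : eqhom (autK S A) \c fmap (autV S) (eta A) = eqhom (autVK S A) \c eta _.
  by rewrite compA eqhomK comp1l.
rewrite -[LHS](fmapS_K S) -[RHS](fmapS_K S); congr unS.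
rewrite !fmapM -eta_S -eta_nat fmap_eqhom -autVK_map.
by congr (_ \c _); apply: eqhom_irr.
Qed.

Lemma powfunctor_eta (F : addfunctor C C) n (A : C) :
  (forall B, exists e : S (F B) = F (S B), fmap F (eta B) = eqhom e \c eta _) ->
  exists e : S (powfunctor F n A) = powfunctor F n (S A),
    fmap (powfunctor F n) (eta A) = eqhom e \c eta _.
Proof.
move=> FP; elim: n A => [|n IHn] A /=; first by exists erefl; rewrite comp1l.
have [e ->] := FP A; have [e' e'P] := IHn (F A).
exists (etrans e' (congr1 (powfunctor F n) e)).
by rewrite fmapM e'P fmap_eqhom compA eqhom_comp.
Qed.

Lemma spow_eta (q : int) (A : C) :
  exists e : S (spow S q A) = spow S q (S A),
    fmap (spow S q) (eta A) = eqhom e \c eta _.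
Proof.
case: q => n; apply: powfunctor_eta => B; last exact: autV_eta.
by exists erefl; rewrite eta_S comp1l.
Qed.

End Powers.

(** * Unrolling factorizations into sequences *)

Section FactSeqFunctor.
Import GRing.Theory.
Local Open Scope ring_scope.
Variables (C : addcat) (S : automorphism C) (d : nat) (d_gt0 : (0 < d)%N).
Local Notation T := (cyctwist S d_gt0).
Implicit Types X Y : famcat C 'I_d.

(** The quotient and remainder that define [M_(m+1)] come from those of [M_m]
    by the same case distinction, wrapping around at [d], as the one that
    defines the twist of a factorization. *)
Lemma zrem_next (m : int) :
  match cnext (zrem d_gt0 m) with
  | Some j => ((m + 1) %/ d)%Z = (m %/ d)%Z /\ zrem d_gt0 (m + 1) = j
  | None => ((m + 1) %/ d)%Z = (m %/ d)%Z + 1 /\ zrem d_gt0 (m + 1) = cfst d_gt0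
  end.
Proof.
have d0 : d%:Z != 0 by rewrite eqz_nat -lt0n.
have em := divz_eq m d; set q := (m %/ d)%Z in em *.
have er : (m %% d)%Z = zrem d_gt0 m by rewrite /= gez0_abs // modz_ge0.
rewrite er in em; rewrite /cnext.
case: insubP => [j lt_d ej|].
  have e1 : m + 1 = q * d%:Z + j%:Z by rewrite ej {1}em -addrA -PoszD addn1.
  split; first by rewrite e1 divzMDl // divz_small ?addr0 //= ltz_nat ltn_ord.
  by apply: val_inj; rewrite /= e1 modzMDl modz_small //= ltz_nat ltn_ord.
rewrite -leqNgt => ge_d.
have ed : (zrem d_gt0 m).+1 = d by apply/eqP; rewrite eqn_leq ge_d ltn_ord.
have e1 : m + 1 = (q + 1) * d%:Z + 0.
  by rewrite {1}em -addrA -PoszD addn1 ed mulrDl mul1r addr0.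
split; first by rewrite e1 divzMDl // div0z addr0.
by apply: val_inj; rewrite /= e1 modzMDl mod0z.
Qed.

Lemma ext_next_nat X Y (h : mor X Y) (m m' : int) (e : m' = m + 1) :
  eqhom (ext_next S d_gt0 Y e) \c fmap (spow S (m %/ d)%Z) (fmap T h (zrem d_gt0 m))
  = fmap (spow S (m' %/ d)%Z) (h (zrem d_gt0 m')) \c eqhom (ext_next S d_gt0 X e).
Proof.
move: (ext_next S d_gt0 X e) (ext_next S d_gt0 Y e).
subst m'; rewrite /ext_ob /=; have := zrem_next m.
move: (zrem d_gt0 (m + 1)) ((m + 1) %/ d)%Z => i q'.
case: (cnext _) => [j|] [-> ->] /= eX eY; last exact: spowS_nat.
by rewrite !eqhom_id comp1l comp1r.
Qed.

Variables (A : addcat) (G : addfunctor C A).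

Definition factseq_functor : addfunctor (famcat C 'I_d) (famcat A int).
Proof.
exists (factseq S d_gt0 G) (@factseq_hom _ S d d_gt0 A G).
by split=> *; apply: functional_extensionality_dep => n;
  rewrite /factseq_hom ?fmapD ?fmap1 ?fmapM.
Defined.

(** The comparison [gam] for unrolling: the [m]-th term obtained from [T X] is
    the [m+1]-st obtained from [X], up to an equality of objects. *)
Definition factseq_twist X :
    mor (factseq_functor (T X)) (seqtwist A (factseq_functor X)) :=
  fun n => fmap G (eqhom (ext_next S d_gt0 X (factseq_degree n))).

Lemma factseq_twist_nat X Y (h : mor X Y) :
  factseq_twist Y \c fmap factseq_functor (fmap T h)
  = fmap (seqtwist A) (fmap factseq_functor h) \c factseq_twist X.
Proof.
apply: functional_extensionality_dep => n.
by rewrite /= /factseq_twist /factseq_hom -!fmapM ext_next_nat.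
Qed.

Lemma factseq_twist_iso X : is_iso (factseq_twist X).
Proof.
apply: is_iso_fam => n; apply: (is_iso_fmap (fmapP G)); exact: is_iso_eqhom.
Qed.

Lemma factseq_mapE X (f : mor X (T X)) :
  factseq_map G f = factseq_twist X \c fmap factseq_functor f.
Proof. by apply: functional_extensionality_dep => n; apply: fmapM. Qed.

Lemma factseq_triangle_functor (P : twclass T) (Q : twclass (seqtwist A)) :
  (forall X : twob P, twc Q (factseq_map G (tmap X))) ->
  induces_triangle_functor G P Q.
Proof.
move=> obQ; exists obQ.
exists (lift_comm factseq_twist_nat factseq_mapE obQ).
exists (lift_hhom factseq_twist_nat factseq_mapE obQ).
split; last exact: lift_triangle_functor factseq_twist_iso _ _ _.
by move=> X Y phi; rewrite (lift_hhomE _ factseq_twist_iso).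
Qed.

End FactSeqFunctor.

(** * The vanishing of d-fold composites *)

Section Complexes.
Local Open Scope ring_scope.
Variables (C : addcat) (S : automorphism C) (eta : forall A : C, mor A (S A)).
Hypothesis eta_nat : forall (A B : C) (h : mor A B), eta B \c h = fmap S h \c eta A.
Hypothesis eta_S : forall A : C, eta (S A) = fmap S (eta A).
Variables (d : nat) (d_ge2 : (2 <= d)%N) (A : addcat) (G : addfunctor C A).

(** A [d]-fold composite in the unrolled sequence factors through the image of
    [S^q] of a [d]-fold composite of the factorization, which is [S^q eta]. *)
Lemma factseq_tcomplex (X : famcat C 'I_d)
    (f : mor X (cyctwist S (ltnW d_ge2) X)) :
  (forall N : C, fmap G (eta N) = 0) -> is_factorization eta f ->
  tcomp d (factseq_map G f) = 0.
Proof.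
move=> Geta fP.
have [g ->] := tcomp_lift (@factseq_twist_nat _ S _ _ _ G)
  (@factseq_mapE _ S _ _ _ G) d f.
rewrite [fmap _ _](_ : _ = 0) ?comp0r //.
apply: functional_extensionality_dep => n; rewrite /= /factseq_hom.
set i := zrem _ _; set e := cyc_iter S (ltnW d_ge2) X i.
rewrite -[tcomp d f i]comp1l -(eqhomK e (esym e)) -compA fP.
have [e' e'P] := spow_eta eta_nat eta_S (- n %/ d)%Z (X i).
by rewrite fmapM e'P !fmapM Geta !comp0r.
Qed.

End Complexes.

(** * Reduction modulo a central element *)

Section CentralQuotient.
Import GRing.Theory.
Local Open Scope ring_scope.

Lemma mproj0 (R : pzRingType) (f : R) (f_central : forall g : R, GRing.comm f g)
    (N : lmodType R^c) :
  mproj f_central (0 : N) = 0.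
Proof. by apply: (addIr (mproj f_central 0)); rewrite -mprojD !add0r. Qed.

Lemma qproj_self (R : pzRingType) (f : R) (f_central : forall g : R, GRing.comm f g) :
  qproj f_central f = 0.
Proof.
have <- : qproj f_central 0 = 0.
  by apply: (addIr (qproj f_central 0)); rewrite -qprojD !add0r.
by apply/qprojP/asboolP; exists 1; rewrite subr0 mul1r.
Qed.

(** For [x : mor M N], naturality gives [eta N \c x = fmap S x \c eta M], and
    [eta M] ends in [f]; hence postcomposition with [eta N] has its image in
    [Hom(M, S N) f]. *)
Lemma hom_mod_eta (C : addcat) (S : automorphism C)
    (eta : forall A : C, mor A (S A))
    (eta_nat : forall (A B : C) (h : mor A B), eta B \c h = fmap S h \c eta A)
    (M N : C) (f : endr M) (f_central : forall g : endr M, GRing.comm f g) :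
  (exists h : mor M (S M), eta M = h \c (f : mor M M)) ->
  fmap (compfunctor (qfunctor f_central) (homfunctor M)) (eta N) = 0.
Proof.
move=> [h eh]; apply: linear_ext => x; rewrite -[x]mproj_repr [LHS]qmapE.
rewrite -[RHS](mproj0 f_central (rhom M (S N))); apply/mprojP/asboolP.
exists (fmap S (repr x : mor M N) \c h : rhom M (S N)); rewrite subr0.
by rewrite [LHS]eta_nat eh; apply: compA.
Qed.

Variables (R : pzRingType) (f : R) (f_central : forall g : R, GRing.comm f g).
Variable N : lmodType R^c.

Lemma qtensor_mproj (x : N) (a : R) :
  qtensor x (qproj f_central a) = mproj f_central ((a : R^c) *: x).
Proof. exact: qscaleE. Qed.

(** A balanced [g] is determined by [x |-> g x 1], which is additive and
    vanishes on [N f] because [g (x f) 1 = g x f = 0]; so it factors uniquely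
    through [N/Nf]. *)
Lemma qtensor_is_tensor :
  is_tensor (@qproj R f f_central) (@qtensor R f f_central N).
Proof.
split.
- split.
  + by move=> x y q; rewrite /qtensor mprojD scalerDr.
  + by move=> x q r; rewrite /qtensor scalerDl.
  + by move=> x a q; rewrite -[q]qproj_repr [_ * _]qmulE !qtensor_mproj scalerA.
- by move=> x q r; rewrite /qtensor scalerA.
- move=> Z g [gDl gDr gM].
  have g1 x a : g x (qproj f_central a) = g ((a : R^c) *: x) (qproj f_central 1).
    by rewrite gM [_ * _]qmulE mulr1.
  have g0 x : g x 0 = 0 by apply: (addIr (g x 0)); rewrite -gDr !add0r.
  have gB x y q : g (x - y) q = g x q - g y q.
    by apply: (addIr (g y q)); rewrite -gDl !subrK.
  pose u (y : qmod f_central N) := g (repr y) (qproj f_central 1).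
  have uE x : u (mproj f_central x) = g x (qproj f_central 1).
    have /mprojP/asboolP[y ey] := mproj_repr (mproj f_central x).
    by apply/eqP; rewrite -subr_eq0 -gB ey -g1 qproj_self g0.
  exists u; split.
  + split.
    * move=> y z; rewrite -[y]mproj_repr -[z]mproj_repr -mprojD !uE.
      exact: gDl.
    * by move=> x q; rewrite -[q]qproj_repr qtensor_mproj uE -g1.
  + move=> v [vD vE]; apply: funext => y; rewrite -[y]mproj_repr uE.
    by rewrite vE qtensor_mproj scale1r.
Qed.

End CentralQuotient.

Theorem theorem3p1 (C : addcat) (S : automorphism C)
    (eta : forall A : C, mor A (S A))
    (eta_nat : forall (A B : C) (h : mor A B), eta B \c h = fmap S h \c eta A)
    (eta_S : forall A : C, eta (S A) = fmap S (eta A))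
    (d : nat) (d_ge2 : 2 <= d) (d_even : ~~ odd d) (M : C) :
  induces_triangle_functor (homfunctor M)
    (factorization d_ge2 eta_nat eta_S d_even) (all_seq (modcat (endr M)))
  /\
  (forall (f : endr M) (f_central : forall g : endr M, GRing.comm f g),
    (exists h : mor M (S M), eta M = h \c (f : mor M M)) ->
    (forall N : C, is_tensor (@qproj (endr M) f f_central)
                     (@qtensor (endr M) f f_central (rhom M N)))
    /\
    induces_triangle_functor (compfunctor (qfunctor f_central) (homfunctor M))
      (factorization d_ge2 eta_nat eta_S d_even)
      (tcomplex (modcat (qring f_central)) d_even)).
Proof.
split; first exact: factseq_triangle_functor.
move=> f f_central eta_f; split=> [N|]; first exact: qtensor_is_tensor.
apply: factseq_triangle_functor => X.
apply: factseq_tcomplex (tobP X) => // N; exact: hom_mod_eta.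
Qed.
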